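(* Let $G$ be a countable residually finite group. Let $n\in\mathbb{N}$, let $A\in M_{n\times n}(\mathbb{Z}G)$ be self-adjoint, and let $(G_k)_{k\in\mathbb{N}}$ be a sequence of finite index, normal subgroups of $G$ that is adapted to $A$. For $k\in\mathbb{N}$ let $A_k\in M_{n\times n}(\mathbb{Z}(G/G_k))$ be the image of $A$ under the canonical projection. Then, for all $k\in\mathbb{N}_{\ge2}$, we have $$\bigl|b^{(2)}(A;G)-b^{(2)}(A_k;G/G_k)\bigr|\le n\cdot\Bigl(1-\frac1{kd}\Bigr)^{k^2}+\frac{n\cdot\log d}{\log k},$$ where $d:=\|R_A^{(2)}\|$ is the operator norm of $R_A^{(2)}$.
   Context: For a group $\Gamma$, $\ell^2\Gamma$ is the Hilbert space of square-summable functions $\Gamma\to\mathbb{C}$. For $B\in M_{n\times n}(\mathbb{Z}\Gamma)$, $R_B^{(2)}:(\ell^2\Gamma)^n\to(\ell^2\Gamma)^n$ is the bounded operator given by right multiplication by $B$, and $b^{(2)}(B;\Gamma):=\dim_{\mathcal{R}\Gamma}\ker(R_B^{(2)})$. Here, $\dim_{\mathcal{R}\Gamma}$ is the von Neumann dimension: for a closed $\Gamma$-invariant subspace $V\subset(\ell^2\Gamma)^n$ with orthogonal projection $P_V$, $\dim_{\mathcal{R}\Gamma}V=\sum_{i=1}^n\langle P_V(e_i),e_i\rangle$, where $e_i$ has $\delta_e$ in position $i$ and $0$ elsewhere. $B$ is self-adjoint if it equals its transpose with the entrywise involution $\sum a_gg\mapsto\sum a_gg^{-1}$ applied. A sequence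 $(G_k)_{k\in\mathbb{N}}$ of finite index, normal subgroups of $G$ is adapted to $A$ if for all $k\in\mathbb{N}$ all entries of the diagonals of $A^0,A^1,\dots,A^{k^2}$ have support in $\{e\}\cup(G\setminus G_k)$, i.e., on these diagonals all coefficients belonging to elements of $G_k\setminus\{e\}$ vanish. *)

(* Defs.v *)
From HB Require Import structures.
From mathcomp Require Import all_boot all_order all_algebra finmap.
From mathcomp Require Import complex monalg.
From mathcomp Require Import boolp classical_sets functions cardinality.
From mathcomp Require Import reals ereal topology normedtype esum exp.
From mathcomp Require summability.
Set Implicit Arguments.
Unset Strict Implicit.
Unset Printing Implicit Defensive.
Import Order.TTheory GRing.Theory Num.Theory numFieldNormedType.Exports.
Local Open Scope classical_set_scope.
Local Open Scope ring_scope.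

(** * Normal subgroups and quotients of possibly infinite groups *)

Record normalSubgroup (G : groupType) := NormalSubgroup {
  nsubgroup :> groupClosed G;
  nsubgroupJ : forall x y : G, x \in nsubgroup -> (x ^ y)%g \in nsubgroup }.

Section QuotientGroup.
Variables (G : groupType) (N : normalSubgroup G).
Local Open Scope group_scope.

Definition coset_rel : rel G := fun x y => (x^-1 * y) \in N.

Fact coset_rel_refl : reflexive coset_rel.
Proof. by move=> x; rewrite /coset_rel mulVg gpred1. Qed.

Fact coset_rel_sym : symmetric coset_rel.
Proof. by move=> x y; rewrite /coset_rel -gpredV invgM invgK. Qed.

Fact coset_rel_trans : transitive coset_rel.
Proof.
move=> y x z xy yz; rewrite /coset_rel.
by have := gpredM _ _ xy yz; rewrite mulgA mulgK.
Qed.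

Canonical coset_equiv :=
  EquivRel coset_rel coset_rel_refl coset_rel_sym coset_rel_trans.

Local Open Scope quotient_scope.

Definition quotientGroup := {eq_quot coset_equiv}.

HB.instance Definition _ := Choice.on quotientGroup.
HB.instance Definition _ := EqQuotient.on quotientGroup.

Definition qproj (x : G) : quotientGroup := \pi_quotientGroup x.

Lemma qprojP x y : reflect (qproj x = qproj y) (x^-1 * y \in N).
Proof. exact: (@eqquotP _ coset_equiv quotientGroup). Qed.

Lemma qproj_repr (x : quotientGroup) : qproj (repr x) = x.
Proof. exact: reprK. Qed.

Definition qmul (x y : quotientGroup) := qproj (repr x * repr y).
Definition qinv (x : quotientGroup) := qproj (repr x)^-1.

Lemma qprojM x y : qmul (qproj x) (qproj y) = qproj (x * y).
Proof.
apply/qprojP; set a := repr _; set b := repr _.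
have /qprojP ax : qproj a = qproj x by exact: qproj_repr.
have /qprojP by_ : qproj b = qproj y by exact: qproj_repr.
have -> : (a * b)^-1 * (x * y) = (b^-1 * y) * (a^-1 * x) ^ y.
  by rewrite conjgE invgM !mulgA mulgK.
by rewrite gpredM // nsubgroupJ.
Qed.

Lemma qprojV x : qinv (qproj x) = qproj x^-1.
Proof.
apply/qprojP; set a := repr _; rewrite invgK.
have /qprojP xa : qproj x = qproj a by rewrite qproj_repr.
have -> : a * x^-1 = (x^-1 * a) ^ x^-1 by rewrite conjgE invgK !mulgA mulgV mul1g.
exact: nsubgroupJ.
Qed.

Fact qmulA : associative qmul.
Proof.
move=> x y z; rewrite -(qproj_repr x) -(qproj_repr y) -(qproj_repr z).
by rewrite !qprojM mulgA.
Qed.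

Fact qmul1g : left_id (qproj 1) qmul.
Proof. by move=> x; rewrite -(qproj_repr x) qprojM mul1g. Qed.

Fact qmulg1 : right_id (qproj 1) qmul.
Proof. by move=> x; rewrite -(qproj_repr x) qprojM mulg1. Qed.

Fact qmulVg : left_inverse (qproj 1) qinv qmul.
Proof. by move=> x; rewrite -(qproj_repr x) qprojV qprojM mulVg. Qed.

Fact qmulgV : right_inverse (qproj 1) qinv qmul.
Proof. by move=> x; rewrite -(qproj_repr x) qprojV qprojM mulgV. Qed.

HB.instance Definition _ := isGroup.Build quotientGroup
  qmulA qmul1g qmulg1 qmulVg qmulgV.

Definition finite_index : Prop := finite_set [set: quotientGroup].

End QuotientGroup.

Definition residually_finite (G : groupType) : Prop :=
  forall g : G, g <> 1%g ->
    exists2 N : normalSubgroup G, finite_index N & g \notin N.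

(** * The integral group ring *)

(* [{malg int[G]}] carries a ring structure in the library only over monoids
   without nontrivial units, hence the alias. *)
Definition groupRing (G : groupType) := {malg int[G]}.
HB.instance Definition _ (G : groupType) := GRing.Zmodule.on (groupRing G).

Section GroupRing.
Variable G : groupType.
Implicit Types a b c : groupRing G.

Definition gr1 : groupRing G := << 1 *g 1%g >>.
Definition grmul a b : groupRing G :=
  \sum_(g <- msupp a) \sum_(h <- msupp b) << a@_g * b@_h *g (g * h)%g >>.

Lemma grmulw (d1 d2 : {fset G}) a b :
  (msupp a `<=` d1)%fset -> (msupp b `<=` d2)%fset ->
  grmul a b = \sum_(g <- d1) \sum_(h <- d2) << a@_g * b@_h *g (g * h)%g >>.
Proof.
move=> le1 le2; rewrite /grmul (big_fset_incl _ le1) /=.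
  apply/eq_bigr=> g _; apply/big_fset_incl => // h _ /mcoeff_outdom ->.
  by rewrite mulr0 monalgU0.
move=> g _ /mcoeff_outdom ag.
by rewrite big1 // => h _; rewrite ag mul0r monalgU0.
Qed.

Lemma grmulDl : left_distributive grmul +%R.
Proof.
move=> a b c; set d := (msupp a `|` msupp b)%fset.
rewrite (@grmulw d (msupp c) a) ?fsubsetUl // (@grmulw d (msupp c) b) ?fsubsetUr //.
rewrite (@grmulw d (msupp c) (a + b)) ?msuppD_le //.
rewrite -big_split /=; apply/eq_bigr => g _.
rewrite -big_split /=; apply/eq_bigr => h _.
by rewrite mcoeffD mulrDl monalgUD.
Qed.

Lemma grmulDr : right_distributive grmul +%R.
Proof.
move=> c a b; set d := (msupp a `|` msupp b)%fset.
rewrite (@grmulw (msupp c) d c a) ?fsubsetUl // (@grmulw (msupp c) d c b) ?fsubsetUr //.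
rewrite (@grmulw (msupp c) d c (a + b)) ?msuppD_le //.
rewrite -big_split /=; apply/eq_bigr => g _.
rewrite -big_split /=; apply/eq_bigr => h _.
by rewrite mcoeffD mulrDr monalgUD.
Qed.

Lemma grmul0g : left_zero 0 grmul.
Proof. by move=> a; rewrite /grmul msupp0 big_seq_fset0. Qed.

Lemma grmulg0 : right_zero 0 grmul.
Proof. by move=> a; rewrite /grmul big1 // => g _; rewrite msupp0 big_seq_fset0. Qed.

Lemma grmulUU (x y : int) (g h : G) :
  grmul << x *g g >> << y *g h >> = << x * y *g (g * h)%g >>.
Proof. by rewrite (grmulw msuppU_le msuppU_le) !big_seq_fset1 !mcoeffUU. Qed.

Lemma grmulUg (x : int) (g : G) b :
  grmul << x *g g >> b = \sum_(h <- msupp b) << x * b@_h *g (g * h)%g >>.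
Proof.
rewrite (grmulw msuppU_le (fsubset_refl _)) big_seq_fset1.
by apply/eq_bigr => h _; rewrite mcoeffUU.
Qed.

Lemma grmulgU a (y : int) (h : G) :
  grmul a << y *g h >> = \sum_(g <- msupp a) << a@_g * y *g (g * h)%g >>.
Proof.
rewrite (grmulw (fsubset_refl _) msuppU_le); apply/eq_bigr => g _.
by rewrite big_seq_fset1 mcoeffUU.
Qed.

Lemma grmul1g : left_id gr1 grmul.
Proof.
move=> a; rewrite grmulUg [RHS]monalgE.
by apply/eq_bigr=> g _; rewrite mul1r mul1g.
Qed.

Lemma grmulg1 : right_id gr1 grmul.
Proof.
move=> a; rewrite grmulgU [RHS]monalgE.
by apply/eq_bigr=> g _; rewrite mulr1 mulg1.
Qed.

Lemma grmul_suml I (r : seq I) (F : I -> groupRing G) b :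
  grmul (\sum_(i <- r) F i) b = \sum_(i <- r) grmul (F i) b.
Proof. exact: (big_morph (grmul^~ b) (fun x y => grmulDl x y b) (grmul0g b)). Qed.

Lemma grmul_sumr I (r : seq I) (F : I -> groupRing G) a :
  grmul a (\sum_(i <- r) F i) = \sum_(i <- r) grmul a (F i).
Proof. exact: (big_morph (grmul a) (grmulDr a) (grmulg0 a)). Qed.

Lemma grmulEl a b : grmul a b = \sum_(g <- msupp a) grmul << a@_g *g g >> b.
Proof. by apply/eq_bigr=> g _; rewrite grmulUg. Qed.

Lemma grmulEr a b : grmul a b = \sum_(h <- msupp b) grmul a << b@_h *g h >>.
Proof.
by rewrite /grmul exchange_big; apply/eq_bigr=> h _; rewrite -/(grmul _ _) grmulgU.
Qed.

Lemma grmulA : associative grmul.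
Proof.
move=> a b c; rewrite [LHS]grmulEl (grmulEl a b) grmul_suml; apply/eq_bigr => g _.
rewrite (grmulEl b c) (grmulEr _ b) grmul_sumr grmul_suml; apply/eq_bigr => h _.
rewrite (grmulEr _ c) grmul_sumr [RHS]grmulEr; apply/eq_bigr => k _.
by rewrite !grmulUU mulrA mulgA.
Qed.

Lemma gr1_neq0 : gr1 != 0.
Proof. by rewrite monalgU_eq0 oner_eq0. Qed.

HB.instance Definition _ := GRing.Zmodule_isNzRing.Build (groupRing G)
  grmulA grmul1g grmulg1 grmulDl grmulDr gr1_neq0.

End GroupRing.

(* Pushforward of coefficients along a map of groups: ring homomorphism if [f]
   is a group homomorphism, anti-homomorphism if [f] is the inversion. *)
Definition groupRing_map (G H : groupType) (f : G -> H) (a : groupRing G) :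
    groupRing H :=
  \sum_(g <- msupp a) << a@_g *g f g >>.

Definition groupRing_star (G : groupType) : groupRing G -> groupRing G :=
  groupRing_map (fun g : G => g^-1)%g.

Definition selfadjoint (G : groupType) n (A : 'M[groupRing G]_n) : Prop :=
  A = map_mx (@groupRing_star G) A^T.

Definition quotient_mx (G : groupType) (N : normalSubgroup G) n
    (A : 'M[groupRing G]_n) : 'M[groupRing (quotientGroup N)]_n :=
  map_mx (groupRing_map (@qproj G N)) A.

Definition adapted (G : groupType) n (A : 'M[groupRing G]_n)
    (N : nat -> normalSubgroup G) : Prop :=
  (forall k, finite_index (N k)) /\
  (forall k m : nat, (m <= k ^ 2)%N -> forall (i : 'I_n) (g : G),
     g \in msupp ((A ^+ m) i i) -> g = 1%g \/ g \notin N k).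

(** * The Hilbert space (l^2 G)^n and right multiplication operators *)

Section L2.
Variables (R : realType) (G : groupType).

Definition l2 : set (G -> R[i]) :=
  [set x | summable [set: G] (fun g => (complex.Re (`|x g| ^+ 2))%:E)].

(* The sum is the unconditional one (limit over finite subsets of [G]), taken
   in the normed space [R[i]^o]; it converges for [x], [y] in [l2]. *)
Definition l2_dot (x y : G -> R[i]) : R[i] :=
  summability.sum ((fun g => x g * (y g)^*) : G -> R[i]^o).

Variable n : nat.
Implicit Types (x y : 'I_n -> G -> R[i]) (V : set ('I_n -> G -> R[i])).

Definition l2n : set ('I_n -> G -> R[i]) := [set x | forall i, l2 (x i)].

Definition l2n_dot x y : R[i] := \sum_(i < n) l2_dot (x i) (y i).

Definition l2n_norm x : R := Num.sqrt (complex.Re (l2n_dot x x)).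

(* [x |-> x * B] for the row vector [x], with
   [(u * a)(g) = \sum_h u(g h^-1) a(h)] for [u] in l^2 G and [a] in Z[G]. *)
Definition rmul_op (B : 'M[groupRing G]_n) x : 'I_n -> G -> R[i] :=
  fun j g => \sum_(i < n) \sum_(h <- msupp (B i j))
    x i (g * h^-1)%g * ((B i j)@_h)%:~R.

Definition op_norm (T : ('I_n -> G -> R[i]) -> ('I_n -> G -> R[i])) : R :=
  sup [set l2n_norm (T x) | x in [set x | l2n x /\ l2n_norm x <= 1]].

Definition op_ker (T : ('I_n -> G -> R[i]) -> ('I_n -> G -> R[i])) :
    set ('I_n -> G -> R[i]) :=
  [set x | l2n x /\ T x = 0].

(* For a closed subspace [V] of (l^2 G)^n and [x] in (l^2 G)^n, there is exactly
   one such [y]; [0] is a junk value. *)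
Definition orth_proj V x : 'I_n -> G -> R[i] :=
  xget 0 [set y | V y /\ forall v, V v -> l2n_dot (x - y) v = 0].

Definition std_vec (i : 'I_n) : 'I_n -> G -> R[i] :=
  fun j g => ((j == i) && (g == 1%g))%:R.

(* The sum is a nonnegative real number, whence the harmless [Re]. *)
Definition vN_dim V : R :=
  complex.Re (\sum_(i < n) l2n_dot (orth_proj V (std_vec i)) (std_vec i)).

Definition b2 (B : 'M[groupRing G]_n) : R := vN_dim (op_ker (rmul_op B)).

End L2.

Arguments rmul_op R {G n} B x.
Arguments b2 R {G n} B.

(* Main.v *)
Require Import Defs.
From HB Require Import structures.
From mathcomp Require Import all_boot all_order all_algebra.
From mathcomp Require Import finmap complex monalg ring lra zify.
From mathcomp Require Import unstable mathcomp_extra boolp fsbigop.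
From mathcomp Require Import classical_sets functions cardinality reals exp.
From mathcomp Require Import ereal interval_inference topology normedtype.
From mathcomp Require Import sequences esum convex.
From mathcomp Require summability.
Set Implicit Arguments.
Unset Strict Implicit.
Unset Printing Implicit Defensive.
Import Order.TTheory GRing.Theory Num.Theory numFieldNormedType.Exports.
Local Open Scope classical_set_scope.
Local Open Scope ring_scope.

(** Write tr p for the von Neumann trace of p(A), where p is a real polynomial;
    it is a combination of the integers [ring_trace A l], the traces of A^l.  Two
    facts turn the kernel dimensions into statements about these traces.

    First, if c > 0 and c >= |A|^2, the powers of 1 - A^2/c decrease to the
    orthogonal projection onto ker A.  So b2(A) is the limit of
    tr (1 - X^2/c)^m, and b2(A) is at most tr h^2 and at most
    tr ((1 - X^2/c) h^2) whenever h(0) = 1 ([b2_limit]).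

    Secondly, over a finite group tr p is the normalised sum of the p(x), x
    running through the eigenvalues of a symmetric integer matrix.  The product
    of the nonzero eigenvalues is, up to sign, a coefficient of the characteristic
    polynomial, hence a nonzero integer, so that the sum of the log x^2 over
    x <> 0 is nonnegative ([finite_group_spectrum]).  That A is adapted says that
    A and A_k have the same traces up to degree k^2 ([quotient_spectrum]).

    For the bound b2(A) <= b2(A_k) + n F it is enough to have a polynomial
    p = (1 - X^2/|A|^2) h^2 of degree at most k^2 with h(0) = 1 and a weight
    lam >= 0 such that p(x) + lam log x^2 <= F for all x <> 0: summing over the
    eigenvalues of A_k, the logarithms only help ([b2_le_quotient]).  The norm of
    A_k can exceed that of A, therefore the inequality is needed on the whole
    line; beyond |A| the factor 1 - X^2/|A|^2 is negative and outweighs the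
    logarithm.  For h^2 the Fejér kernel is used (h = 1 if k = 2): in
    s = x^2/|A|^2 = sin^2 t the function (sin (m t) / (m sin t))^2, m odd, is a
    polynomial of degree m - 1, bounded on [0, 1] by 1 and by 1/(m^2 s).  As 1/u
    is convex in log u, this gives F close to log |A| / log m, where m is about
    k^2/2 ([fejer_contr_log_le]).  The gain of log m over log k pays for the error
    terms.

    For b2(A_k) <= b2(A) + n F the same argument has to be run on A, for which no
    determinant bound is at hand.  It is run on A_j with j going to infinity
    ([quotient_le_b2]): the eigenvalues of A_j beyond |A| contribute a high moment
    of A divided by a power of a number larger than |A|, which tends to 0, and
    b2(A_j) is at most tr (1 - X^2/|A|^2)^(2l) for j large, which tends to b2(A).

    All this is for |A|^2 >= 2.  If |A|^2 < 2, integrality forces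
    tr A^4 <= tr A^2, and then (1 - X^2)^2 from above and log y <= y - 1 from
    below show that both dimensions equal n - tr A^2 ([b2_eq_of_small]). *)

(** * Unconditional sums *)

Section HasSum.
Variables (I : choiceType) (K : numFieldType).
Implicit Types (f g : I -> K) (J : {fset I}).

(** Convergence along finite subsets, in the epsilon form that makes the linear
    algebra of such sums elementary. *)
Definition has_sum f (l : K) := forall e, 0 < e ->
  exists J0, forall J, (J0 `<=` J)%fset -> `|\sum_(i <- J) f i - l| < e.

Lemma has_sumD f g a b : has_sum f a -> has_sum g b ->
  has_sum (fun i => f i + g i) (a + b).
Proof.
move=> fa gb e e0.
have e2 : 0 < e / 2 by rewrite divr_gt0.
have [J1 h1] := fa _ e2; have [J2 h2] := gb _ e2.
exists (J1 `|` J2)%fset => J; rewrite fsubUset => /andP[J1J J2J].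
rewrite big_split /= opprD addrACA (le_lt_trans (ler_normD _ _)) //.
by rewrite [e]splitr ltrD ?h1 ?h2.
Qed.

Lemma has_sumZ c f a : has_sum f a -> has_sum (fun i => c * f i) (c * a).
Proof.
move=> fa e e0; have c1 : 0 < 1 + `|c| by rewrite ltr_pwDl.
have [J h] := fa _ (divr_gt0 e0 c1); exists J => J' JJ'.
rewrite -mulr_sumr -mulrBr normrM.
have /le_lt_trans -> // : `|c| * `|\sum_(i <- J') f i - a| <=
    (1 + `|c|) * `|\sum_(i <- J') f i - a|.
  by rewrite ler_wpM2r // lerDr.
by rewrite mulrC -ltr_pdivlMr // h.
Qed.

Lemma eq_has_sum f g a : f =1 g -> has_sum f a -> has_sum g a.
Proof. by move=> fg fa e /fa[J h]; exists J => J' /h; under eq_bigr do rewrite fg. Qed.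

Lemma has_sum_fset f J : (forall i, i \notin J -> f i = 0) ->
  has_sum f (\sum_(i <- J) f i).
Proof.
move=> f0 e e0; exists J => J' JJ'.
by rewrite (big_fset_incl _ JJ') ?subrr ?normr0 // => i _ /f0.
Qed.

Lemma has_sum0 : has_sum (fun=> 0) 0.
Proof. by move=> e e0; exists fset0 => J _; rewrite big1 // subr0 normr0. Qed.

Lemma has_sum_sum (T : Type) (r : seq T) (F : T -> I -> K) (a : T -> K) :
  (forall t, has_sum (F t) (a t)) ->
  has_sum (fun i => \sum_(t <- r) F t i) (\sum_(t <- r) a t).
Proof.
move=> Fa; elim: r => [|t r ih].
  by rewrite big_nil; apply: eq_has_sum has_sum0 => i; rewrite big_nil.
rewrite big_cons; apply: eq_has_sum (has_sumD (Fa t) ih) => i.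
by rewrite big_cons.
Qed.

Lemma has_sum_reindex (h h' : I -> I) f a : cancel h h' -> cancel h' h ->
  has_sum f a -> has_sum (f \o h) a.
Proof.
move=> hK h'K fa e /fa[J hJ].
exists [fset h' j | j in J]%fset => J' JJ'.
have hinj := can_inj hK.
have -> : \sum_(i <- J') (f \o h) i = \sum_(i <- [fset h j | j in J']%fset) f i.
  by rewrite big_imfset //= => x y _ _; exact: hinj.
apply: hJ; apply/fsubsetP => j jJ; apply/imfsetP; exists (h' j) => /=.
  by apply: (fsubsetP JJ'); apply/imfsetP; exists j.
by rewrite h'K.
Qed.

Lemma has_sum_le_bound f a C :
  (forall J, `|\sum_(i <- J) f i| <= C) -> has_sum f a -> `|a| <= C.
Proof.
move=> fC fa; have C0 : 0 <= C by apply: le_trans (fC fset0); exact: normr_ge0.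
rewrite real_leNgt ?normr_real ?ger0_real //; apply/negP => Ca.
have /fa[J hJ] : 0 < `|a| - C by rewrite subr_gt0.
have := hJ _ (fsubset_refl J); apply/negP.
rewrite -real_leNgt ?realB ?normr_real ?ger0_real //.
rewrite lerBlDr distrC; apply: le_trans (lerD (lexx _) (fC J)).
by rewrite -{1}(subrK (\sum_(i <- J) f i) a) ler_normD.
Qed.

End HasSum.

Section HasSumReal.
Variables (I : choiceType) (R : realType).
Implicit Types (f : I -> R) (J : {fset I}).

Lemma le_sum_fset f J J' : (forall i, 0 <= f i) -> (J `<=` J')%fset ->
  \sum_(i <- J) f i <= \sum_(i <- J') f i.
Proof.
move=> f0 JJ'; pose g i := if i \in J then f i else 0.
have -> : \sum_(i <- J) f i = \sum_(i <- J) g i.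
  by apply: eq_big_seq => i iJ; rewrite /g iJ.
rewrite (big_fset_incl _ JJ') /=; last by move=> i _ /negbTE iJ; rewrite /g iJ.
by apply: ler_sum => i _; rewrite /g; case: ifP.
Qed.

Lemma has_sum_nonneg f C : (forall i, 0 <= f i) ->
  (forall J, \sum_(i <- J) f i <= C) -> exists l, has_sum f l.
Proof.
move=> f0 fC; pose S := [set \sum_(i <- J) f i | J in [set: {fset I}]].
have hS : has_sup S.
  split; first by exists (\sum_(i <- fset0) f i); exists fset0.
  by exists C => _ [J _ <-].
exists (sup S) => e e0; have [_ [J _ <-] SJ] := sup_adherent e0 hS.
exists J => J' JJ'.
have le1 : \sum_(i <- J') f i <= sup S by apply: ub_le_sup; [case: hS|exists J'].
have le2 := le_sum_fset f0 JJ'.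
by rewrite ltr_norml; apply/andP; split; lra.
Qed.

Lemma has_sum_abs f C : (forall J, \sum_(i <- J) `|f i| <= C) ->
  exists l, has_sum f l.
Proof.
move=> fC; have [i|J|a fa] := @has_sum_nonneg (fun i => `|f i|) C _ _ => //.
have [i|J|b fb] := @has_sum_nonneg (fun i => `|f i| + f i) (C + C).
- by have := ler_norm (- f i); rewrite normrN; lra.
- rewrite big_split /= lerD // (le_trans _ (fC J)) // ler_sum // => i _.
  exact: ler_norm.
exists (b + -1 * a); apply: eq_has_sum (has_sumD fb (has_sumZ (-1) fa)) => i.
by rewrite mulN1r addrAC subrr add0r.
Qed.

End HasSumReal.

Section HasSumComplex.
Variables (I : choiceType) (R : realType).
Implicit Types (f : I -> R[i]) (J : {fset I}).

Lemma complex_gt0 (e : R[i]) : 0 < e -> exists2 e' : R, 0 < e' & e = (e'%:C)%C.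
Proof.
case: e => a b; rewrite ltcE /= => /andP[/eqP -> a0]; exists a => //.
Qed.

Lemma has_sumC (f : I -> R) a : has_sum f a -> has_sum (fun i => (f i)%:C%C) a%:C%C.
Proof.
move=> fa _ /complex_gt0[e e0 ->]; have [J hJ] := fa _ e0; exists J => J' /hJ.
rewrite -(rmorph_sum (real_complex R)) -rmorphB /= normc_def /= expr0n /= addr0.
by rewrite sqrtr_sqr ltcR.
Qed.

Lemma has_sum_Re f a : has_sum f a ->
  has_sum (fun i => complex.Re (f i)) (complex.Re a).
Proof.
move=> fa e e0; have e0' : 0 < e%:C%C by rewrite ltcR.
have [J hJ] := fa _ e0'; exists J => J' /hJ.
rewrite -(raddf_sum (@complex.Re R)) -raddfB -ltcR.
by apply: le_lt_trans; exact: normc_ge_Re.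
Qed.

Lemma has_sum_absC f (C : R) :
  (forall J, \sum_(i <- J) complex.Re `|f i| <= C) -> exists l, has_sum f l.
Proof.
move=> fC.
have leRe z : `|complex.Re z| <= complex.Re `|z| :> R.
  by rewrite -lecR (le_trans (normc_ge_Re z)) // lecE /= eqxx lexx normc_def.
have leIm z : `|complex.Im z| <= complex.Re `|z| :> R.
  have := leRe (z * 'i%C); rewrite ReiNIm normrN normrM.
  by rewrite (_ : `|'i%C| = 1) ?mulr1 // normc_def /= expr0n expr1n add0r sqrtr1.
have [J|a fa] := @has_sum_abs _ _ (fun i => complex.Re (f i)) C.
  by rewrite (le_trans _ (fC J)) // ler_sum.
have [J|b fb] := @has_sum_abs _ _ (fun i => complex.Im (f i)) C.
  by rewrite (le_trans _ (fC J)) // ler_sum.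
exists (a%:C%C + 'i%C * b%:C%C).
apply: eq_has_sum (has_sumD (has_sumC fa) (has_sumZ _ (has_sumC fb))) => i.
by rewrite -complexE.
Qed.

Lemma has_sum_conj f a : has_sum f a -> has_sum (fun i => (f i)^*) a^*.
Proof.
move=> fa e e0; have [J hJ] := fa _ e0; exists J => J' /hJ.
by rewrite -(rmorph_sum (@Num.conj _)) -rmorphB normcJ.
Qed.

(** Links the epsilon form to the limit by which the scalar product is defined. *)
Lemma summability_sumE f a :
  has_sum f a -> summability.sum (f : I -> R[i]^o) = a.
Proof.
move=> fa; have Ff := @summability.totally_filter I.
apply: (@cvg_lim R[i]^o _ _ _ Ff) => //.
apply: (@cvgrPdist_lt R[i] R[i]^o _ _ Ff _ _).2 => e e0.
have [J hJ] := fa _ e0; exists J => // J' /= /hJ.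
by rewrite distrC /summability.partial_sum big_seq_fsetE.
Qed.

End HasSumComplex.

Section L2Theory.
Variables (R : realType) (G : groupType).
Implicit Types (x y : G -> R[i]) (J : {fset G}).

Definition sqabs (z : R[i]) : R := complex.Re (`|z| ^+ 2).

Lemma sqabsE z : sqabs z = complex.Re z ^+ 2 + complex.Im z ^+ 2.
Proof. by rewrite /sqabs -add_Re2_Im2. Qed.

Lemma sqabsC z : (sqabs z)%:C%C = z * z^*.
Proof. by rewrite sqabsE add_Re2_Im2 sqr_normc. Qed.

Lemma sqabs_ge0 z : 0 <= sqabs z.
Proof. by rewrite sqabsE addr_ge0 ?sqr_ge0. Qed.

Lemma l2P x : l2 x <-> exists C, forall J, \sum_(g <- J) sqabs (x g) <= C.
Proof.
rewrite /l2 /= /summable; split=> [xoo|[C xC]]; last first.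
  apply: (@le_lt_trans _ _ C%:E); last exact: ltry.
  apply: ge_ereal_sup => _ [A [finA _] <-].
  rewrite fsbig_finite //= -/(sqabs _); under eq_bigr do rewrite -/(sqabs _) ger0_norm ?sqabs_ge0 //.
  by rewrite sumEFin lee_fin; exact: xC.
set S := esum _ _ in xoo.
have S0 : (0 <= S)%E by apply: esum_ge0.
exists (fine S) => J; rewrite -lee_fin fineK; last by rewrite ge0_fin_numE.
apply: esum_ge; exists [set` J]; first by split.
rewrite -fsbig_seq ?fset_uniq // -sumEFin lee_sum // => g _.
by rewrite gee0_abs // lee_fin sqabs_ge0.
Qed.

End L2Theory.

(** * The Hilbert space of square-summable vectors *)

Lemma le_sum_has_sum (I : choiceType) (R : realType) (f : I -> R) a (J : {fset I}) :
  (forall i, 0 <= f i) -> has_sum f a -> \sum_(i <- J) f i <= a.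
Proof.
move=> f0 fa; rewrite leNgt; apply/negP => aJ.
have [J0 hJ] : exists J0, forall J', (J0 `<=` J')%fset ->
  `|\sum_(i <- J') f i - a| < \sum_(i <- J) f i - a by apply: fa; rewrite subr_gt0.
have := hJ _ (fsubsetUl J0 J); apply/negP; rewrite -leNgt.
have le1 := le_sum_fset f0 (fsubsetUr J0 J).
by rewrite (le_trans _ (ler_norm _)) // lerD2r.
Qed.

Lemma has_sum_le (I : choiceType) (R : realType) (f : I -> R) a (C : R) :
  (forall J : {fset I}, \sum_(i <- J) f i <= C) -> has_sum f a -> a <= C.
Proof.
move=> fC fa; rewrite leNgt; apply/negP => Ca.
have [J hJ] : exists J0, forall J, (J0 `<=` J)%fset ->
  `|\sum_(i <- J) f i - a| < a - C by apply: fa; rewrite subr_gt0.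
have := hJ _ (fsubset_refl J); have := fC J.
by rewrite ltr_norml => ? /andP[? ?]; lra.
Qed.

Section L2.
Variables (R : realType) (G : groupType).
Implicit Types (x y z : G -> R[i]) (J : {fset G}) (c : R[i]) (t : R).

Lemma sqabsM c w : sqabs (c * w) = sqabs c * sqabs w :> R.
Proof. by apply: complexI; rewrite rmorphM /= !sqabsC rmorphM /=; ring. Qed.

Lemma sqabsD (v w : R[i]) : sqabs (v + w) <= 2 * sqabs v + 2 * sqabs w.
Proof.
rewrite !sqabsE !raddfD /=; set a := complex.Re v; set b := complex.Im v.
set a' := complex.Re w; set b' := complex.Im w.
have := sqr_ge0 (a - a'); have := sqr_ge0 (b - b'); lra.
Qed.

Lemma l2Z c x : l2 x -> l2 (fun g => c * x g).
Proof.
move=> /l2P[C xC]; apply/l2P; exists (sqabs c * C) => J.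
under eq_bigr do rewrite sqabsM.
by rewrite -mulr_sumr ler_wpM2l // sqabs_ge0.
Qed.

Lemma l2D x y : l2 x -> l2 y -> l2 (x + y).
Proof.
move=> /l2P[C xC] /l2P[D yD]; apply/l2P; exists (2 * C + 2 * D) => J.
apply: (@le_trans _ _ (\sum_(g <- J) (2 * sqabs (x g) + 2 * sqabs (y g)))).
  by apply: ler_sum => g _; exact: sqabsD.
by rewrite big_split /= -!mulr_sumr lerD // ler_wpM2l.
Qed.

Lemma l2_0 : l2 (0 : G -> R[i]).
Proof.
by apply/l2P; exists 0 => J; rewrite big1 // => g _; rewrite sqabsE /= expr0n addr0.
Qed.

Lemma re_normM_le t (v w : R[i]) : 0 < t ->
  2 * complex.Re `|v * w^*| <= t * sqabs v + t^-1 * sqabs w.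
Proof.
move=> t0; rewrite normrM normcJ !normc_def !sqabsE /= mulr0 subr0.
set p := _ + _; set q := _ + _.
have p0 : 0 <= p by rewrite addr_ge0 ?sqr_ge0.
have q0 : 0 <= q by rewrite addr_ge0 ?sqr_ge0.
rewrite -{2}(sqr_sqrtr p0) -{2}(sqr_sqrtr q0).
set a := Num.sqrt p; set b := Num.sqrt q.
have := sqr_ge0 (t * a - b); rewrite -(pmulr_rge0 _ (_ : 0 < t^-1)) ?invr_gt0 //.
have -> : t^-1 * (t * a - b) ^+ 2 = t * a ^+ 2 - 2 * (a * b) + t^-1 * b ^+ 2.
  by field; rewrite gt_eqF.
lra.
Qed.

Lemma l2_dotP x y : l2 x -> l2 y ->
  has_sum (fun g => x g * (y g)^*) (l2_dot x y).
Proof.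
move=> /l2P[C xC] /l2P[D yD].
suff [l hl] : exists l, has_sum (fun g => x g * (y g)^*) l.
  by rewrite /l2_dot (summability_sumE hl).
apply: (@has_sum_absC _ _ _ (C + D)) => J.
apply: (le_trans _ (lerD (xC J) (yD J))); rewrite -big_split [leRHS]/=.
apply: ler_sum => g _; have := @re_normM_le 1 (x g) (y g) ltr01.
rewrite invr1 !mul1r.
have : 0 <= complex.Re `|x g * (y g)^*| by rewrite normc_def /= sqrtr_ge0.
set a := complex.Re _ => a0 h; lra.
Qed.

Lemma l2_dotE x y a : has_sum (fun g => x g * (y g)^*) a -> l2_dot x y = a.
Proof. by move=> h; rewrite /l2_dot (summability_sumE h). Qed.

Lemma l2_sqabsP x : l2 x -> has_sum (@sqabs R \o x) (complex.Re (l2_dot x x)).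
Proof.
move=> lx; apply: eq_has_sum (has_sum_Re (l2_dotP lx lx)) => g.
by rewrite -sqabsC.
Qed.

Lemma l2_dot_real x : l2 x -> l2_dot x x = (complex.Re (l2_dot x x))%:C%C.
Proof.
move=> lx; apply: l2_dotE; apply: eq_has_sum (has_sumC (l2_sqabsP lx)) => g /=.
by rewrite sqabsC.
Qed.

Lemma l2_tr x h : l2 x -> l2 (fun g => x (g * h)%g).
Proof.
move=> lx; apply/l2P; exists (complex.Re (l2_dot x x)) => J.
apply: le_sum_has_sum => [g|]; first exact: sqabs_ge0.
have hK : cancel (fun g => g * h)%g (fun g => g * h^-1)%g by move=> g; rewrite mulgK.
have h'K : cancel (fun g => g * h^-1)%g (fun g => g * h)%g by move=> g; rewrite mulgVK.
by apply: eq_has_sum (has_sum_reindex hK h'K (l2_sqabsP lx)) => g.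
Qed.

(** Stands in for Cauchy-Schwarz: letting t grow while [x] tends to 0 gives the
    continuity of the scalar product. *)
Lemma l2_dot_young x y t : l2 x -> l2 y -> 0 < t ->
  2 * complex.Re `|l2_dot x y| <=
  t * complex.Re (l2_dot x x) + t^-1 * complex.Re (l2_dot y y).
Proof.
move=> lx ly t0; have t1 : 0 < t^-1 by rewrite invr_gt0.
set B := (X in _ <= X).
rewrite mulrC -ler_pdivlMr // -lecR.
have -> : (complex.Re `|l2_dot x y|)%:C%C = `|l2_dot x y| by rewrite normc_def.
apply: has_sum_le_bound (l2_dotP lx ly) => J; apply: le_trans (ler_norm_sum _ _ _) _.
have -> : \sum_(g <- J) `|x g * (y g)^*| =
  (\sum_(g <- J) complex.Re `|x g * (y g)^*|)%:C%C.
  by rewrite rmorph_sum; apply: eq_bigr => g _; rewrite normc_def.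
rewrite lecR ler_pdivlMr // mulrC mulr_sumr.
apply: (@le_trans _ _ (\sum_(g <- J) (t * sqabs (x g) + t^-1 * sqabs (y g)))).
  by apply: ler_sum => g _; exact: re_normM_le.
rewrite big_split /= -!mulr_sumr lerD // ler_pM2l //.
  by apply: le_sum_has_sum (l2_sqabsP lx) => g; exact: sqabs_ge0.
by apply: le_sum_has_sum (l2_sqabsP ly) => g; exact: sqabs_ge0.
Qed.

End L2.

Section L2n.
Variables (R : realType) (G : groupType) (n : nat).
Local Notation vec := ('I_n -> G -> R[i]).
Implicit Types (x y z : vec) (J : {fset G}) (c : R[i]) (t : R).

Definition vscale c x : vec := fun i g => c * x i g.
Definition sqnorm x : R := complex.Re (l2n_dot x x).

Lemma l2nD x y : l2n x -> l2n y -> l2n (x + y).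
Proof. by move=> lx ly i; apply: l2D. Qed.

Lemma l2nZ c x : l2n x -> l2n (vscale c x).
Proof. by move=> lx i; apply: l2Z. Qed.

Lemma vscaleN1 x : vscale (-1) x = - x.
Proof. by apply/funext => i; apply/funext => g; rewrite /vscale mulN1r. Qed.

Lemma l2nB x y : l2n x -> l2n y -> l2n (x - y).
Proof. by move=> lx ly; apply: l2nD => //; rewrite -vscaleN1; apply: l2nZ. Qed.

Lemma l2n0 : l2n (0 : vec).
Proof. by move=> i; apply: l2_0. Qed.

Lemma l2n_dotDl x y z : l2n x -> l2n y -> l2n z ->
  l2n_dot (x + y) z = l2n_dot x z + l2n_dot y z.
Proof.
move=> lx ly lz; rewrite /l2n_dot -big_split; apply: eq_bigr => i _ /=.
apply: l2_dotE; apply: eq_has_sum (has_sumD (l2_dotP _ _) (l2_dotP _ _)) => // g.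
by rewrite -mulrDl.
Qed.

Lemma l2n_dotZl c x y : l2n x -> l2n y ->
  l2n_dot (vscale c x) y = c * l2n_dot x y.
Proof.
move=> lx ly; rewrite /l2n_dot mulr_sumr; apply: eq_bigr => i _ /=.
apply: l2_dotE; apply: eq_has_sum (has_sumZ c (l2_dotP _ _)) => // g.
by rewrite mulrA.
Qed.

Lemma l2n_dotC x y : l2n x -> l2n y -> l2n_dot y x = (l2n_dot x y)^*.
Proof.
move=> lx ly; rewrite /l2n_dot rmorph_sum; apply: eq_bigr => i _ /=.
apply: l2_dotE; apply: eq_has_sum (has_sum_conj (l2_dotP _ _)) => // g.
by rewrite rmorphM /= conjCK mulrC.
Qed.

Lemma l2n_dotBl x y z : l2n x -> l2n y -> l2n z ->
  l2n_dot (x - y) z = l2n_dot x z - l2n_dot y z.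
Proof.
move=> lx ly lz; rewrite l2n_dotDl // -?vscaleN1 ?l2n_dotZl ?mulN1r //.
exact: l2nZ.
Qed.

Lemma vscale0 x : vscale 0 x = 0.
Proof. by apply/funext => i; apply/funext => g; rewrite /vscale mul0r. Qed.

Lemma l2n_dot0l y : l2n y -> l2n_dot 0 y = 0.
Proof. by move=> ly; rewrite -(vscale0 0) l2n_dotZl ?mul0r //; apply: l2n0. Qed.

Lemma l2n_dot0r y : l2n y -> l2n_dot y 0 = 0.
Proof. by move=> ly; rewrite (l2n_dotC l2n0) // l2n_dot0l // rmorph0. Qed.

Lemma l2n_dotDr x y z : l2n x -> l2n y -> l2n z ->
  l2n_dot z (x + y) = l2n_dot z x + l2n_dot z y.
Proof.
move=> lx ly lz; rewrite (l2n_dotC (l2nD lx ly)) // l2n_dotDl // rmorphD /=.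
by rewrite -!l2n_dotC.
Qed.

Lemma l2n_dotZr c x y : l2n x -> l2n y ->
  l2n_dot x (vscale c y) = c^* * l2n_dot x y.
Proof.
move=> lx ly; rewrite (l2n_dotC (l2nZ c ly)) // l2n_dotZl // rmorphM /=.
by rewrite -!l2n_dotC.
Qed.

Lemma l2n_dotBr x y z : l2n x -> l2n y -> l2n z ->
  l2n_dot z (x - y) = l2n_dot z x - l2n_dot z y.
Proof.
move=> lx ly lz; rewrite (l2n_dotC (l2nB lx ly)) // l2n_dotBl // rmorphB /=.
by rewrite -!l2n_dotC.
Qed.

Lemma sqnormC x : l2n x -> l2n_dot x x = (sqnorm x)%:C%C.
Proof.
move=> lx; rewrite /sqnorm raddf_sum rmorph_sum; apply: eq_bigr => i _ /=.
exact: l2_dot_real.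
Qed.

Lemma sum_sqabs_le x J : l2n x -> \sum_(i < n) \sum_(g <- J) sqabs (x i g) <= sqnorm x.
Proof.
move=> lx; rewrite /sqnorm raddf_sum; apply: ler_sum => i _ /=.
by apply: le_sum_has_sum (l2_sqabsP _) => // g; exact: sqabs_ge0.
Qed.

Lemma sqabs_le_sqnorm x i g : l2n x -> sqabs (x i g) <= sqnorm x.
Proof.
move=> lx; apply: le_trans (sum_sqabs_le [fset g]%fset lx).
rewrite (bigD1 i) //= big_seq_fset1 lerDl sumr_ge0 // => j _.
by rewrite sumr_ge0 // => ? _; exact: sqabs_ge0.
Qed.

Lemma sqnorm_ge0 x : l2n x -> 0 <= sqnorm x.
Proof.
move=> lx; apply: le_trans (sum_sqabs_le fset0 lx).
by rewrite sumr_ge0 // => i _; rewrite sumr_ge0 // => ? _; exact: sqabs_ge0.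
Qed.

Lemma sqnorm_eq0 x : l2n x -> sqnorm x = 0 -> x = 0.
Proof.
move=> lx x0; apply/funext => i; apply/funext => g.
have := sqabs_le_sqnorm i g lx; rewrite x0 sqabsE => h.
apply/eqP; rewrite eq_complex /=; move: h.
by rewrite real_leNgt ?num_real // lt0r paddr_eq0 ?sqr_ge0 // !sqrf_eq0 addr_ge0 ?sqr_ge0 // andbT negbK.
Qed.

(** Fatou: square-summability and the norm are controlled by finite partial sums,
    so that both pass to pointwise limits. *)
Lemma l2n_bound x C : (forall J, \sum_(i < n) \sum_(g <- J) sqabs (x i g) <= C) ->
  l2n x /\ sqnorm x <= C.
Proof.
move=> xC; have lx : l2n x.
  move=> i; apply/l2P; exists C => J; apply: le_trans (xC J).
  rewrite (bigD1 i) //= lerDl sumr_ge0 // => j _.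
  by rewrite sumr_ge0 // => ? _; exact: sqabs_ge0.
split => //; rewrite /sqnorm raddf_sum /=.
apply: (@has_sum_le _ _ (fun g => \sum_(i < n) sqabs (x i g))).
  by move=> J; rewrite exchange_big.
apply: has_sum_sum => i; exact: l2_sqabsP.
Qed.

Lemma l2n_dot_young x y t : l2n x -> l2n y -> 0 < t ->
  2 * complex.Re `|l2n_dot x y| <= t * sqnorm x + t^-1 * sqnorm y.
Proof.
move=> lx ly t0; rewrite /sqnorm !raddf_sum /= !mulr_sumr -big_split /=.
apply: (@le_trans _ _ (\sum_(i < n) 2 * complex.Re `|l2_dot (x i) (y i)|)).
  rewrite -mulr_sumr ler_pM2l //.
  have E (w : R[i]) : (complex.Re `|w|)%:C%C = `|w| :> R[i] by rewrite normc_def.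
  rewrite -lecR E rmorph_sum /=; under eq_bigr do rewrite E.
  exact: ler_norm_sum.
by apply: ler_sum => i _; exact: l2_dot_young.
Qed.

Lemma sqnormD x y : l2n x -> l2n y ->
  sqnorm (x + y) <= 2 * sqnorm x + 2 * sqnorm y.
Proof.
move=> lx ly; apply: (l2n_bound _).2 => J.
apply: (@le_trans _ _ (2 * (\sum_(i < n) \sum_(g <- J) sqabs (x i g)) + 2 * (\sum_(i < n) \sum_(g <- J) sqabs (y i g)))).
  rewrite !mulr_sumr -big_split; apply: ler_sum => i _ /=.
  by rewrite !mulr_sumr -big_split; apply: ler_sum => g _ /=; exact: sqabsD.
by rewrite lerD // ler_pM2l // sum_sqabs_le.
Qed.

Lemma sqnormZ c x : l2n x -> sqnorm (vscale c x) = sqabs c * sqnorm x.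
Proof.
move=> lx; have lcx := l2nZ c lx; apply: complexI.
rewrite -sqnormC // l2n_dotZl // l2n_dotZr // sqnormC // mulrA rmorphM /=.
by rewrite sqabsC.
Qed.

End L2n.

(** * Completeness and the projection onto a kernel *)

Lemma cauchy_real_cvg (R : realType) (u : nat -> R) :
  (forall e, 0 < e -> exists N, forall m l, (N <= m)%N -> (N <= l)%N ->
     `|u m - u l| < e) -> cvgn u.
Proof.
move=> uC; apply: (@cauchy_cvg R); apply/cauchy_ballP => e e0.
have [N hN] := uC _ e0.
exists (u @` [set m | (N <= m)%N], u @` [set m | (N <= m)%N]) => /=.
  by split; exists N => // m /= Nm; exists m.
by move=> [_ _] [/= [m Nm <-] [l Nl <-]]; exact: hN.
Qed.

Section Complete.
Variables (R : realType) (G : groupType) (n : nat).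
Local Notation vec := ('I_n -> G -> R[i]).

(** A Cauchy sequence converges coordinatewise, and the bound on the finite
    partial sums of the differences survives in the limit. *)
Lemma l2n_complete (u : nat -> vec) : (forall m, l2n (u m)) ->
  (forall e, 0 < e -> exists N, forall m l, (N <= m)%N -> (N <= l)%N ->
     sqnorm (u m - u l) <= e) ->
  exists y, l2n y /\ (forall e, 0 < e ->
     exists N, forall m, (N <= m)%N -> sqnorm (u m - y) <= e).
Proof.
move=> lu uC.
have pC i g e : 0 < e -> exists N, forall m l, (N <= m)%N -> (N <= l)%N ->
    sqabs (u m i g - u l i g) < e ^+ 2.
  move=> e0; have [|N hN] := uC (e ^+ 2 / 2); first by rewrite divr_gt0 ?exprn_gt0.
  exists N => m l Nm Nl; have lB := l2nB (lu m) (lu l).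
  apply: (@le_lt_trans _ _ (e ^+ 2 / 2)); last first.
    by rewrite ltr_pdivrMr // ltr_pMr ?exprn_gt0 // ltr1n.
  exact: le_trans (sqabs_le_sqnorm i g lB) (hN _ _ Nm Nl).
have sq_lt (a e : R) : 0 < e -> a ^+ 2 < e ^+ 2 -> `|a| < e.
  move=> e0 ae; rewrite -(@ltr_pXn2r _ 2) ?nnegrE ?normr_ge0 ?ltW //.
  by rewrite real_normK ?num_real.
have reC i g : cvgn (fun m => complex.Re (u m i g)).
  apply: cauchy_real_cvg => e e0; have [N hN] := pC i g e e0.
  exists N => m l Nm Nl; apply: sq_lt => //; apply: le_lt_trans (hN _ _ Nm Nl).
  by rewrite sqabsE !raddfB lerDl sqr_ge0.
have imC i g : cvgn (fun m => complex.Im (u m i g)).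
  apply: cauchy_real_cvg => e e0; have [N hN] := pC i g e e0.
  exists N => m l Nm Nl; apply: sq_lt => //; apply: le_lt_trans (hN _ _ Nm Nl).
  by rewrite sqabsE !raddfB lerDr sqr_ge0.
pose y : vec := fun i g => Complex (limn (fun m => complex.Re (u m i g)))
                                   (limn (fun m => complex.Im (u m i g))).
have key e : 0 < e -> exists N, forall m, (N <= m)%N ->
    l2n (u m - y) /\ sqnorm (u m - y) <= e.
  move=> e0; have [N hN] := uC _ e0; exists N => m Nm; apply: l2n_bound => J.
  have cv : (fun l => \sum_(i < n) \sum_(g <- J) sqabs (u m i g - u l i g)) @ \oo -->
      \sum_(i < n) \sum_(g <- J) sqabs ((u m - y) i g).
    apply: cvg_big => [|i _]; first exact: add_continuous.
    apply: cvg_big => [|g _]; first exact: add_continuous.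
    rewrite sqabsE !raddfB /=.
    under eq_cvg do rewrite sqabsE !raddfB /=.
    apply: cvgD; rewrite expr2; under eq_cvg do rewrite expr2.
      by apply: cvgM; apply: cvgB; [exact: cvg_cst|exact: reC|exact: cvg_cst|exact: reC].
    by apply: cvgM; apply: cvgB; [exact: cvg_cst|exact: imC|exact: cvg_cst|exact: imC].
  rewrite -(cvg_lim _ cv) //; apply: limr_le; first by apply/cvg_ex; eexists; exact: cv.
  exists N => // l /= Nl; apply: le_trans (hN _ _ Nm Nl).
  by apply: (sum_sqabs_le J (l2nB (lu m) (lu l))).
have [N0 /(_ _ (leqnn _))[ly _]] := key _ ltr01.
exists y; split; last first.
  by move=> e /key[N hN]; exists N => m /hN[].
have -> : y = u N0 - (u N0 - y) by rewrite opprB addrCA subrr addr0.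
exact: l2nB.
Qed.

End Complete.

Section Moment.
Variables (R : realType) (G : groupType) (n : nat).
Local Notation vec := ('I_n -> G -> R[i]).
Variables (a : vec -> vec) (e : vec) (c : R).
Hypothesis a_l2 : forall x, l2n x -> l2n (a x).
Hypothesis aD : forall x y, a (x + y) = a x + a y.
Hypothesis aZ : forall k x, a (vscale k x) = vscale k (a x).
Hypothesis a_sym : forall x y, l2n x -> l2n y -> l2n_dot (a x) y = l2n_dot x (a y).
Hypothesis c_gt0 : 0 < c.
Hypothesis a_bnd : forall x, l2n x -> sqnorm (a x) <= c * sqnorm x.
Hypothesis le2 : l2n e.
Implicit Types p q : {poly R}.

(** The vector p(a) e. *)
Definition poly_vec p : vec :=
  fun j g => \sum_(l < size p) (p`_l)%:C%C * iter l a e j g.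

Lemma poly_vec_wide N p : (size p <= N)%N ->
  poly_vec p = fun j g => \sum_(l < N) (p`_l)%:C%C * iter l a e j g.
Proof.
move=> sN; apply/funext => j; apply/funext => g; rewrite /poly_vec.
rewrite (big_ord_widen N (fun l => (p`_l)%:C%C * iter l a e j g)) // big_mkcond.
apply: eq_bigr => l _ /=; case: ltnP => // sl.
by rewrite nth_default // rmorph0 mul0r.
Qed.

Lemma poly_vecD p q : poly_vec (p + q) = poly_vec p + poly_vec q.
Proof.
pose N := maxn (size p) (size q).
rewrite (@poly_vec_wide N) ?(@poly_vec_wide N p) ?(@poly_vec_wide N q) ?leq_maxl ?leq_maxr ?size_polyD //.
apply/funext => j; apply/funext => g /=; rewrite -[RHS]big_split /=.
by apply: eq_bigr => l _; rewrite coefD rmorphD mulrDl.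
Qed.

Lemma poly_vecZ t p : poly_vec (t *: p) = vscale t%:C%C (poly_vec p).
Proof.
rewrite (@poly_vec_wide (size p)) ?size_scale_leq //.
apply/funext => j; apply/funext => g; rewrite /vscale mulr_sumr.
by apply: eq_bigr => l _; rewrite coefZ rmorphM mulrA.
Qed.

Lemma poly_vec0 : poly_vec 0 = 0.
Proof. by apply/funext => j; apply/funext => g; rewrite /poly_vec size_poly0 big_ord0. Qed.

Lemma poly_vecC t : poly_vec t%:P = vscale t%:C%C e.
Proof.
rewrite (@poly_vec_wide 1) ?size_polyC_leq1 //; apply/funext => j; apply/funext => g.
by rewrite big_ord1 coefC.
Qed.

Lemma poly_vecXn l : poly_vec 'X^l = iter l a e.
Proof.
apply/funext => j; apply/funext => g; rewrite /poly_vec size_polyXn big_ord_recr /=.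
rewrite big1 ?add0r => [|i _]; first by rewrite coefXn eqxx rmorph1 mul1r.
by rewrite coefXn ltn_eqF // rmorph0 mul0r.
Qed.

Lemma poly_vecMX p : poly_vec (p * 'X) = a (poly_vec p).
Proof.
have a0 : a 0 = 0 by rewrite -(vscale0 0) aZ !vscale0.
rewrite -[p]coefK poly_def mulr_suml !(big_morph poly_vec poly_vecD poly_vec0) (big_morph a aD a0).
by apply: eq_bigr => l _; rewrite -scalerAl -exprSr !poly_vecZ !poly_vecXn aZ.
Qed.

Lemma l2n_poly_vec p : l2n (poly_vec p).
Proof.
elim/poly_ind: p => [|p t ih]; first by rewrite poly_vec0; apply: l2n0.
by rewrite poly_vecD poly_vecC poly_vecMX; apply: l2nD; [exact: a_l2|exact: l2nZ].
Qed.

(** As a is symmetric, it moves from one side of the scalar product to the other;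
    the scalar product on the cyclic subspace of e only depends on the product
    of the two polynomials. *)
Lemma dot_poly_vec p q : l2n_dot (poly_vec p) (poly_vec q) = l2n_dot e (poly_vec (p * q)).
Proof.
have lp := l2n_poly_vec; have lap r := a_l2 (lp r); have lc k := l2nZ k le2.
elim/poly_ind: p q => [|p t ih] q.
  by rewrite mul0r poly_vec0 l2n_dot0l // l2n_dot0r.
rewrite poly_vecD poly_vecC poly_vecMX l2n_dotDl // a_sym // -poly_vecMX ih mulrDl poly_vecD.
rewrite l2n_dotDr // l2n_dotZl // mul_polyC poly_vecZ l2n_dotZr //.
by rewrite -!mulrA ['X * q]mulrC; congr (_ + _ * _); rewrite [RHS]conjc_real.
Qed.

Definition moment p : R := complex.Re (l2n_dot e (poly_vec p)).

Lemma momentC p : l2n_dot e (poly_vec p) = (moment p)%:C%C.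
Proof.
have e1 : poly_vec 1 = e.
  rewrite (_ : 1 = 1%:P) // poly_vecC; apply/funext => j; apply/funext => g.
  by rewrite /vscale mul1r.
apply/esym/RRe_real/CrealP; have lp := l2n_poly_vec p.
by rewrite -l2n_dotC // -{1}e1 dot_poly_vec mulr1.
Qed.

Lemma sqnorm_poly_vec p : sqnorm (poly_vec p) = moment (p ^+ 2).
Proof. by rewrite /sqnorm dot_poly_vec -expr2. Qed.

Lemma momentD p q : moment (p + q) = moment p + moment q.
Proof. by rewrite /moment poly_vecD l2n_dotDr ?raddfD //; exact: l2n_poly_vec. Qed.

Lemma momentZ t p : moment (t *: p) = t * moment p.
Proof.
apply: complexI; rewrite rmorphM /= -!momentC poly_vecZ l2n_dotZr //; last exact: l2n_poly_vec.
by rewrite [X in X * _]conjc_real.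
Qed.

Lemma momentB p q : moment (p - q) = moment p - moment q.
Proof. by rewrite -scaleN1r momentD momentZ mulN1r. Qed.

(** With c at least the squared norm of a, this polynomial takes a to an operator
    between 0 and 1 which is the identity exactly on the kernel of a. *)
Definition contr : {poly R} := 1 - c^-1 *: 'X^2.

Lemma sqnorm_contr p : moment (contr * p ^+ 2) = sqnorm (poly_vec p) - c^-1 * sqnorm (a (poly_vec p)).
Proof.
rewrite -poly_vecMX !sqnorm_poly_vec /contr mulrBl mul1r momentB -scalerAl momentZ.
by rewrite exprMn ['X^2 * _]mulrC.
Qed.

Lemma sqnorm_a_le x : l2n x -> c^-1 * sqnorm (a x) <= sqnorm x.
Proof. by move=> lx; rewrite mulrC ler_pdivrMr // mulrC a_bnd. Qed.

Lemma moment_contr_ge0 m : 0 <= moment (contr ^+ m).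
Proof.
rewrite -(odd_double_half m) exprD -mul2n mulnC exprM.
case: (odd m); rewrite ?expr1 ?expr0 ?mul1r.
  by rewrite sqnorm_contr subr_ge0 sqnorm_a_le //; exact: l2n_poly_vec.
by rewrite -sqnorm_poly_vec sqnorm_ge0 //; exact: l2n_poly_vec.
Qed.

(** Even and odd powers are treated apart, so that each difference is of the form
    (1 - a^2/c) h(a)^2 or h(a)^2 applied to a cyclic vector. *)
Lemma moment_contrS m : moment (contr ^+ m.+1) <= moment (contr ^+ m).
Proof.
have lp := l2n_poly_vec.
suff h : 0 <= moment ('X^2 * contr ^+ m).
  rewrite exprS {1}/contr mulrBl mul1r momentB -scalerAl momentZ.
  by rewrite lerBlDr lerDl mulr_ge0 // invr_ge0 ltW.
rewrite -(odd_double_half m) exprD -mul2n mulnC exprM.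
case: (odd m); rewrite ?expr1 ?expr0 ?mul1r.
  rewrite mulrCA -exprMn sqnorm_contr subr_ge0 sqnorm_a_le //.
by rewrite -exprMn -sqnorm_poly_vec sqnorm_ge0.
Qed.

(** The moments of the powers of [contr] decrease and are nonnegative, hence
    converge; the squared distance of two of the vectors [contr]^m e is a
    combination of three of these moments, so the vectors form a Cauchy sequence.
    Their limit y is the projection of e: a y = 0 because consecutive moments
    become equal, and the scalar products with kernel vectors are constant along
    the sequence.  The two upper bounds for z express that h(a) e - y, where
    h(0) = 1, has a nonnegative squared norm, respectively that a
    multiplies this squared norm by at most c. *)
Lemma kernel_projection : exists (y : vec) (z : R),
  [/\ l2n y, a y = 0,
      forall v, l2n v -> a v = 0 -> l2n_dot (e - y) v = 0,
      l2n_dot y e = z%:C%C &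
      [/\ (fun m => moment (contr ^+ m)) @ \oo --> z,
          forall h : {poly R}, h.[0] = 1 -> z <= moment (h ^+ 2) &
          forall h : {poly R}, h.[0] = 1 -> z <= moment (contr * h ^+ 2)]].
Proof.
have lp := l2n_poly_vec.
pose al m := moment (contr ^+ m); pose w m := poly_vec (contr ^+ m).
have al_cvg : cvgn al.
  apply: nonincreasing_is_cvgn.
    by apply/nonincreasing_seqP => m; exact: moment_contrS.
  by exists 0 => _ [m _ <-]; exact: moment_contr_ge0.
set z := limn al in al_cvg.
have al_z eps : 0 < eps -> exists N, forall m, (N <= m)%N -> `|al m - z| <= eps.
  move=> e0; have /cvgrPdist_le/(_ _ e0)[N _ hN] := al_cvg.
  by exists N => m Nm; rewrite distrC; exact: hN.
have wB m l : sqnorm (w m - w l) = al (m + m)%N - 2 * al (m + l)%N + al (l + l)%N.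
  rewrite /w -vscaleN1 -(rmorph1 (real_complex R)) -rmorphN -poly_vecZ -poly_vecD sqnorm_poly_vec.
  rewrite scaleN1r sqrrB -!exprM momentD momentB.
  rewrite -exprD -scaler_nat momentZ.
  by rewrite !muln2 -!addnn.
have [y [ly wy]] : exists y, l2n y /\ (forall e, 0 < e ->
     exists N, forall m, (N <= m)%N -> sqnorm (w m - y) <= e).
  apply: l2n_complete => [m|eps e0]; first exact: lp.
  have [|N hN] := al_z (eps / 4); first by rewrite divr_gt0.
  exists N => m l Nm Nl; rewrite wB.
  have := hN (m + m)%N (leq_trans Nm (leq_addl _ _)).
  have := hN (m + l)%N (leq_trans Nm (leq_addr _ _)).
  have := hN (l + l)%N (leq_trans Nl (leq_addl _ _)).
  rewrite !ler_norml => /andP[? ?] /andP[? ?] /andP[? ?]; lra.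
have dot_lim v k : l2n v -> (forall eps, 0 < eps -> exists N, forall m, (N <= m)%N ->
     complex.Re `|l2n_dot (w m) v - k| <= eps) -> l2n_dot y v = k.
  move=> lv wk; apply/eqP; rewrite -subr_eq0 -normr_eq0.
  have absC (x : R[i]) : `|x| = (complex.Re `|x|)%:C%C by rewrite normc_def.
  rewrite absC -(rmorph0 (real_complex R)) (inj_eq (@complexI R)) eq_le; apply/andP; split; last first.
    by rewrite -lecR -absC normr_ge0.
  apply/ler_addgt0Pl => eps e0; rewrite addr0.
  (* makes the term t^-1 |v|^2 of the Young inequality at most eps *)
  pose t := (sqnorm v + 1) / eps.
  have v0 := sqnorm_ge0 lv; have t0 : 0 < t by rewrite divr_gt0 // ltr_wpDl.
  have [|N1 h1] := wy (eps / 4 / t); first by rewrite divr_gt0 // divr_gt0.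
  have [|N2 h2] := wk (eps / 4); first by rewrite divr_gt0 // divr_gt0.
  pose m := maxn N1 N2.
  have {}h1 := h1 m (leq_maxl _ _); have {}h2 := h2 m (leq_maxr _ _).
  have := l2n_dot_young (l2nB (lp (contr ^+ m)) ly) lv t0.
  rewrite l2n_dotBl // -/(w m) => h3.
  have h4 : t * sqnorm (w m - y) <= eps / 4 by rewrite mulrC -ler_pdivlMr.
  have h5 : t^-1 * sqnorm v <= eps.
    rewrite /t invf_div mulrAC ler_pdivrMr ?ltr_wpDl //.
    by rewrite ler_pM2l // lerDl.
  have : complex.Re `|l2n_dot y v - k| <=
      complex.Re `|l2n_dot (w m) v - l2n_dot y v| + complex.Re `|l2n_dot (w m) v - k|.
    rewrite -lecR rmorphD /= -!absC (distrC (l2n_dot (w m) v) (l2n_dot y v)).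
    by rewrite -{1}(subrK (l2n_dot (w m) v) (l2n_dot y v)) -addrA ler_normD.
  lra.
have ay : a y = 0.
  apply: sqnorm_eq0; first exact: a_l2.
  apply/eqP; rewrite eq_le sqnorm_ge0 ?andbT; last exact: a_l2.
  apply/ler_addgt0Pl => eps e0; rewrite addr0.
  have [|N1 h1] := wy (eps / 4 / c); first by rewrite divr_gt0 // divr_gt0.
  have [|N2 h2] := al_z (eps / 8 / c); first by rewrite divr_gt0 // divr_gt0.
  pose m := maxn N1 N2.
  have {}h1 := h1 m (leq_maxl _ _).
  have lwy : l2n (w m - y) := l2nB (lp _) ly.
  have -> : a y = a (w m) + vscale (-1) (a (w m - y)).
    rewrite -aZ -aD; congr a; rewrite vscaleN1 opprB.
    by apply/funext => i; apply/funext => g /=; rewrite /= addrC subrK.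
  apply: le_trans (sqnormD (a_l2 (lp _)) (l2nZ _ (a_l2 lwy))) _.
  rewrite sqnormZ; last exact: a_l2.
  have -> : sqabs (-1) = 1 :> R.
    by rewrite /sqabs normrN normr1 expr1n.
  have h3 := a_bnd lwy.
  have h4 : c * sqnorm (w m - y) <= eps / 4 by rewrite mulrC -ler_pdivlMr.
  have : sqnorm (a (w m)) <= eps / 4.
    have := sqnorm_contr (contr ^+ m).
    rewrite sqnorm_poly_vec -exprM -exprS => E.
    have {E} : c^-1 * sqnorm (a (poly_vec (contr ^+ m))) = al (m * 2)%N - al (m * 2).+1.
      by rewrite /al E opprB addrC subrK.
    move/(congr1 ( *%R c)); rewrite mulVKf ?gt_eqF // => ->.
    rewrite mulrC -ler_pdivlMr //.
    have Nm : (N2 <= m * 2)%N by rewrite muln2 -addnn (leq_trans (leq_maxr N1 N2)) // leq_addr.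
    have := h2 _ Nm; have := h2 _ (leqW Nm).
    have -> : eps / 8 / c = (eps / 4 / c) / 2 by field; rewrite gt_eqF.
    rewrite !ler_norml => /andP[? ?] /andP[? ?]; lra.
  lra.
have poly_vec_ker p v : l2n v -> a v = 0 -> l2n_dot (poly_vec p) v = p.[0]%:C%C * l2n_dot e v.
  move=> lv av; elim/poly_ind: p => [|p t ih].
    by rewrite poly_vec0 horner0 rmorph0 mul0r l2n_dot0l.
  have lap r := a_l2 (lp r); have lc k := l2nZ k le2.
  rewrite poly_vecD poly_vecMX poly_vecC l2n_dotDl // a_sym // av l2n_dotZl //.
  rewrite hornerMXaddC mulr0 add0r l2n_dot0r //.
  by rewrite add0r.
have contr0 m : (contr ^+ m).[0] = 1.
  by rewrite horner_exp /contr hornerD hornerN hornerZ hornerXn hornerC expr0n mulr0 subr0 expr1n.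
have orth v : l2n v -> a v = 0 -> l2n_dot y v = l2n_dot e v.
  move=> lv av; apply: dot_lim => // eps e0; exists 0%N => m _.
  by rewrite /w poly_vec_ker // contr0 rmorph1 mul1r subrr normr0 ltW.
have ye : l2n_dot y e = z%:C%C.
  apply: dot_lim => // eps /al_z[N hN]; exists N => m /hN.
  have -> : l2n_dot (w m) e = (al m)%:C%C.
    by rewrite /w (l2n_dotC le2) // momentC [LHS]conjc_real.
  by rewrite -rmorphB normc_def /= expr0n addr0 sqrtr_sqr.
have ey : l2n_dot e y = z%:C%C by rewrite (l2n_dotC ly) // ye [LHS]conjc_real.
have yy : l2n_dot y y = z%:C%C by rewrite orth.
have hB (h : {poly R}) : h.[0] = 1 -> sqnorm (poly_vec h - y) = moment (h ^+ 2) - z.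
  move=> h0; have hy : l2n_dot (poly_vec h) y = z%:C%C by rewrite poly_vec_ker // h0 rmorph1 mul1r.
  have yh : l2n_dot y (poly_vec h) = z%:C%C by rewrite (l2n_dotC (lp h)) // hy [LHS]conjc_real.
  have lB := l2nB (lp h) ly.
  apply: (@complexI R); rewrite -sqnormC // l2n_dotBl // !l2n_dotBr //.
  rewrite hy yh yy subrr subr0 rmorphB /=; congr (_ - _).
  by rewrite dot_poly_vec -expr2 momentC.
exists y, z; split => //.
  by move=> v lv av; rewrite l2n_dotBl // orth // subrr.
split; first exact: al_cvg.
  by move=> h h0; rewrite -subr_ge0 -hB // sqnorm_ge0 //; exact: l2nB.
move=> h h0; rewrite sqnorm_contr sqnorm_poly_vec.
have aB : a (poly_vec h - y) = a (poly_vec h).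
  by rewrite -vscaleN1 aD aZ ay vscaleN1 subr0.
have := sqnorm_a_le (l2nB (lp h) ly); rewrite aB hB //; lra.
Qed.

End Moment.

(** * Group ring coefficients and boundedness of right multiplication *)

Lemma mcoeff_sum (G : groupType) (I : Type) (r : seq I) (F : I -> groupRing G) g :
  (\sum_(i <- r) F i)@_g = \sum_(i <- r) (F i)@_g.
Proof.
elim: r => [|i r ih]; first by rewrite !big_nil mcoeff0.
by rewrite !big_cons mcoeffD ih.
Qed.

Section Coeff.
Variables (G : groupType).
Implicit Types (a b : groupRing G).

Lemma mcoeff_map (H : groupType) (f : G -> H) a q :
  (groupRing_map f a)@_q = \sum_(g <- msupp a) a@_g *+ (f g == q).
Proof.
rewrite /groupRing_map mcoeff_sum.
by apply: eq_bigr => g _; rewrite mcoeffU.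
Qed.

Lemma sum_mcoeff_eq (J : {fset G}) a g : (msupp a `<=` J)%fset ->
  \sum_(h <- J) a@_h *+ (h == g) = a@_g.
Proof.
move=> aJ; rewrite -(big_fset_incl _ aJ) /=; last first.
  by move=> h _ /mcoeff_outdom ->; rewrite mul0rn.
case: (boolP (g \in msupp a)) => [ga|ga].
  rewrite (big_fsetD1 g) //= eqxx mulr1n big1_fset ?addr0 // => h.
  by rewrite !inE => /andP[/negbTE ->].
rewrite (mcoeff_outdom ga) big1_fset // => h ha _; case: eqP => // hg.
by rewrite -hg ha in ga.
Qed.

Lemma mcoeff_star a g : (groupRing_star a)@_g = a@_(g^-1)%g.
Proof.
rewrite /groupRing_star mcoeff_map -(sum_mcoeff_eq g^-1%g (fsubset_refl _)).
by apply: eq_bigr => h _; rewrite -(inj_eq invg_inj) invgK.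
Qed.

Lemma mcoeffM a b g :
  (a * b)@_g = \sum_(h <- msupp b) a@_(g * h^-1)%g * b@_h.
Proof.
rewrite -[a * b]/(grmul a b) /grmul exchange_big mcoeff_sum.
apply: eq_bigr => h _; rewrite mcoeff_sum.
rewrite -(sum_mcoeff_eq (g * h^-1)%g (fsubset_refl _)) mulr_suml.
apply: eq_bigr => k _; rewrite mcoeffU -mulrnAl; congr (_ *+ nat_of_bool _ * _).
by rewrite -[RHS](inj_eq (mulIg h)) mulgVK.
Qed.

End Coeff.

Section Bounded.
Variables (R : realType) (G : groupType) (n : nat).
Local Notation vec := ('I_n -> G -> R[i]).

Definition bounded (T : vec -> vec) := exists2 C, 0 <= C &
  forall x, l2n x -> l2n (T x) /\ sqnorm (T x) <= C * sqnorm x.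

Lemma bounded_sum (I : Type) (r : seq I) (T : I -> vec -> vec) :
  (forall t, bounded (T t)) -> bounded (fun x => \sum_(t <- r) T t x).
Proof.
move=> Tb; elim: r => [|t r [C C0 ih]].
  exists 0 => // x lx; rewrite big_nil mul0r; split; first exact: l2n0.
  by rewrite /sqnorm l2n_dot0l //; exact: l2n0.
have [D D0 hD] := Tb t; exists (2 * D + 2 * C) => [|x lx].
  by rewrite addr_ge0 // mulr_ge0.
rewrite big_cons; have [l1 b1] := hD x lx; have [l2' b2] := ih x lx.
split; first exact: l2nD.
have := sqnormD l1 l2'; lra.
Qed.

Definition elem_op (i j : 'I_n) (h : G) (k : R[i]) (x : vec) : vec :=
  fun j' g => if j' == j then x i (g * h^-1)%g * k else 0.

Lemma bounded_elem i j h k : bounded (elem_op i j h k).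
Proof.
exists (sqabs k) => [|x lx]; first exact: sqabs_ge0.
apply: l2n_bound => J.
rewrite (bigD1 j) //= [X in _ + X]big1 ?addr0 => [|j' /negbTE j'j]; last first.
  by rewrite big1 // => g _; rewrite /elem_op j'j sqabsE /= expr0n addr0.
apply: (@le_trans _ _ (sqabs k * complex.Re (l2_dot (x i) (x i)))).
  rewrite mulrC; under eq_bigr do rewrite /elem_op eqxx sqabsM.
  rewrite -mulr_suml ler_wpM2r ?sqabs_ge0 //.
  have hK : cancel (fun g => g * h^-1)%g (fun g => g * h)%g by move=> g; rewrite mulgVK.
  have h'K : cancel (fun g => g * h)%g (fun g => g * h^-1)%g by move=> g; rewrite mulgK.
  apply: le_sum_has_sum => [g|]; first exact: sqabs_ge0.
  by apply: eq_has_sum (has_sum_reindex hK h'K (l2_sqabsP (lx i))) => g.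
rewrite ler_wpM2l ?sqabs_ge0 // /sqnorm raddf_sum /= (bigD1 i) //= lerDl.
apply: sumr_ge0 => i' _; have := le_sum_has_sum fset0 (fun g => sqabs_ge0 _) (l2_sqabsP (lx i')).
by rewrite big_seq_fset0.
Qed.

Variable B : 'M[groupRing G]_n.

Lemma rmul_opE x : rmul_op R B x =
  \sum_(j < n) \sum_(i < n) \sum_(h <- msupp (B i j)) elem_op i j h ((B i j)@_h)%:~R x.
Proof.
have app (I : Type) (r : seq I) (F : I -> vec) j g :
    (\sum_(t <- r) F t) j g = \sum_(t <- r) F t j g.
  by elim: r => [|t r ih]; rewrite ?big_nil ?big_cons //= -ih.
apply/funext => j; apply/funext => g; rewrite app (bigD1 j) //=.
rewrite [X in _ + X]big1 ?addr0 => [|j' jj']; last first.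
  rewrite app big1 // => i _; rewrite app big1 // => h _.
  by rewrite /elem_op eq_sym (negbTE jj').
rewrite app; apply: eq_bigr => i _; rewrite app; apply: eq_bigr => h _.
by rewrite /elem_op eqxx.
Qed.

(** Right multiplication is a finite sum of translations of one coordinate into
    another, scaled by integers. *)
Lemma bounded_rmul : bounded (rmul_op R B).
Proof.
have -> : rmul_op R B = fun x => \sum_(j < n) \sum_(i < n) \sum_(h <- msupp (B i j))
    elem_op i j h ((B i j)@_h)%:~R x by apply/funext => x; exact: rmul_opE.
do 3!(apply: bounded_sum => ?); exact: bounded_elem.
Qed.

Lemma l2n_rmul x : l2n x -> l2n (rmul_op R B x).
Proof. by case: bounded_rmul => C _ h /h[]. Qed.

Lemma rmulD x y : rmul_op R B (x + y) = rmul_op R B x + rmul_op R B y :> vec.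
Proof.
apply/funext => j; apply/funext => g; rewrite -[RHS]big_split.
apply: eq_bigr => i _; rewrite -[RHS]big_split; apply: eq_bigr => h _ /=.
by rewrite -mulrDl.
Qed.

Lemma rmulZ k x : rmul_op R B (vscale k x) = vscale k (rmul_op R B x) :> vec.
Proof.
apply/funext => j; apply/funext => g; rewrite /vscale [RHS]mulr_sumr.
apply: eq_bigr => i _; rewrite mulr_sumr; apply: eq_bigr => h _ /=.
by rewrite mulrA.
Qed.

Local Notation d := (op_norm (rmul_op R B)).

Lemma op_norm_ge0 : 0 <= d.
Proof.
have [C C0 hC] := bounded_rmul.
have N0 : sqnorm (0 : vec) = 0 by rewrite /sqnorm l2n_dot0l //; exact: l2n0.
have l0 := @l2n0 R G n.
apply: (@le_trans _ _ (l2n_norm (rmul_op R B (0 : vec)))); first by rewrite /l2n_norm sqrtr_ge0.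
apply: ub_le_sup; last first.
  exists 0 => //; split; first exact: l2n0.
  by rewrite /l2n_norm -/(sqnorm _) N0 sqrtr0.
exists (Num.sqrt C) => _ [x [lx x1] <-]; have [lBx h] := hC x lx.
rewrite /l2n_norm -/(sqnorm _) ler_wsqrtr // (le_trans h) // ler_piMr //.
rewrite -sqrtr1 /l2n_norm -/(sqnorm _) in x1.
by rewrite ler_sqrt in x1.
Qed.

(** The supremum defining [op_norm] is over the unit ball; it is a genuine upper
    bound because [bounded_rmul] makes the set bounded. *)
Lemma op_norm_le x : l2n x -> sqnorm (rmul_op R B x) <= d ^+ 2 * sqnorm x.
Proof.
move=> lx; have [C C0 hC] := bounded_rmul.
have d0 := op_norm_ge0.
have [|nz] := eqVneq (sqnorm x) 0.
  by move=> x0; have [_] := hC x lx; rewrite x0 !mulr0.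
have N0 : 0 < sqnorm x by rewrite lt0r nz sqnorm_ge0.
pose s := (Num.sqrt (sqnorm x))^-1.
have s2 : s ^+ 2 * sqnorm x = 1 by rewrite /s exprVn sqr_sqrtr ?ltW // mulVf.
have sqabss : sqabs s%:C%C = s ^+ 2 by rewrite sqabsE /= expr0n addr0.
have lsx := l2nZ s%:C%C lx.
have : l2n_norm (rmul_op R B (vscale s%:C%C x)) <= d.
  apply: ub_le_sup; last first.
    exists (vscale s%:C%C x) => //; split => //.
    by rewrite /l2n_norm -/(sqnorm _) sqnormZ // sqabss s2 sqrtr1.
  exists (Num.sqrt C) => _ [y [ly y1] <-]; have [lBx h] := hC y ly.
  rewrite /l2n_norm -/(sqnorm _) ler_wsqrtr // (le_trans h) // ler_piMr //.
  rewrite -sqrtr1 /l2n_norm -/(sqnorm _) in y1.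
  by rewrite ler_sqrt in y1.
rewrite rmulZ /l2n_norm -/(sqnorm _) => le_d.
have : sqnorm (vscale s%:C%C (rmul_op R B x)) <= d ^+ 2.
  rewrite -(@sqr_sqrtr _ (sqnorm _)) ?sqnorm_ge0 ?l2nZ //; last exact/l2nZ/l2n_rmul.
  by rewrite ler_pXn2r ?nnegrE ?sqrtr_ge0.
rewrite sqnormZ ?sqabss; last exact: l2n_rmul.
have s20 : 0 < s ^+ 2 by rewrite exprn_gt0 // invr_gt0 sqrtr_gt0.
move=> h; rewrite -(ler_pM2l s20) (le_trans h) //.
by rewrite mulrCA s2 mulr1.
Qed.

End Bounded.

(** * Right multiplication by a self-adjoint matrix: kernel dimension as a limit of traces *)

Section Selfadjoint.
Variables (R : realType) (G : groupType) (n : nat) (B : 'M[groupRing G]_n).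
Hypothesis Bsa : selfadjoint B.
Local Notation vec := ('I_n -> G -> R[i]).

Lemma selfadjoint_coeff i j g : (B i j)@_g = (B j i)@_(g^-1)%g.
Proof. by rewrite {1}Bsa !mxE mcoeff_star. Qed.

Lemma msupp_selfadjoint i j :
  msupp (B i j) = [fset h^-1%g | h in msupp (B j i)]%fset.
Proof.
apply/fsetP => g; apply/idP/imfsetP => [gB|[h /= hB ->]].
  by exists g^-1%g; rewrite ?invgK //= -mcoeff_neq0 -selfadjoint_coeff mcoeff_neq0.
by rewrite -mcoeff_neq0 selfadjoint_coeff invgK mcoeff_neq0.
Qed.

Lemma l2_dot_tr (x y : G -> R[i]) h : l2 x -> l2 y ->
  l2_dot (fun g => x (g * h^-1)%g) y = l2_dot x (fun g => y (g * h)%g).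
Proof.
move=> lx ly; apply: l2_dotE.
have hK : cancel (fun g => g * h^-1)%g (fun g => g * h)%g by move=> g; rewrite mulgVK.
have h'K : cancel (fun g => g * h)%g (fun g => g * h^-1)%g by move=> g; rewrite mulgK.
apply: eq_has_sum (has_sum_reindex hK h'K (l2_dotP lx (l2_tr h ly))) => g /=.
by rewrite mulgVK.
Qed.

Lemma intC_conj (k : int) : (k%:~R : R[i])^* = k%:~R.
Proof. by rewrite rmorph_int. Qed.

Lemma rmul_sym (x y : vec) : l2n x -> l2n y ->
  l2n_dot (rmul_op R B x) y = l2n_dot x (rmul_op R B y).
Proof.
move=> lx ly.
have L : l2n_dot (rmul_op R B x) y = \sum_(j < n) \sum_(i < n)
   \sum_(h <- msupp (B i j)) ((B i j)@_h)%:~R * l2_dot (fun g => x i (g * h^-1)%g) (y j).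
  apply: eq_bigr => j _; apply: l2_dotE.
  apply: (@eq_has_sum _ _ (fun g => \sum_(i < n) \sum_(h <- msupp (B i j))
    ((B i j)@_h)%:~R * (x i (g * h^-1)%g * (y j g)^*))).
    move=> g; rewrite mulr_suml; apply: eq_bigr => i _.
    by rewrite mulr_suml; apply: eq_bigr => h _; ring.
  apply: has_sum_sum => i; apply: has_sum_sum => h; apply: has_sumZ.
  by apply: l2_dotP => //; exact: l2_tr.
have E : l2n_dot x (rmul_op R B y) = \sum_(i < n) \sum_(j < n)
   \sum_(h <- msupp (B j i)) ((B j i)@_h)%:~R * l2_dot (x i) (fun g => y j (g * h^-1)%g).
  apply: eq_bigr => i _; apply: l2_dotE.
  apply: (@eq_has_sum _ _ (fun g => \sum_(j < n) \sum_(h <- msupp (B j i))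
    ((B j i)@_h)%:~R * (x i g * (y j (g * h^-1)%g)^*))).
    move=> g; rewrite rmorph_sum mulr_sumr; apply: eq_bigr => j _ /=.
    rewrite rmorph_sum mulr_sumr; apply: eq_bigr => h _ /=.
    by rewrite rmorphM /= intC_conj; ring.
  apply: has_sum_sum => j; apply: has_sum_sum => h; apply: has_sumZ.
  by apply: l2_dotP => //; exact: l2_tr.
rewrite L E exchange_big; apply: eq_bigr => i _; apply: eq_bigr => j _ /=.
rewrite msupp_selfadjoint big_imfset /=; last by move=> g h _ _; exact: invg_inj.
apply: eq_bigr => h _; rewrite l2_dot_tr // selfadjoint_coeff invgK.
by [].
Qed.

Lemma std_vec_supp (f : G -> R[i]) (i j : 'I_n) a : (j == i -> f 1%g = a) ->
  has_sum (fun g => f g * (std_vec R i j g)^*) (a *+ (j == i)).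
Proof.
move=> fa; have -> : a *+ (j == i) =
    \sum_(g <- [fset (1%g : G)]%fset) f g * (std_vec R i j g)^*.
  rewrite big_seq_fset1 /std_vec eqxx andbT; case: eqP fa => [_ <- //|_ _].
    by rewrite rmorph1 mulr1.
  by rewrite rmorph0 mulr0.
apply: has_sum_fset => g; rewrite inE /std_vec => /negbTE ->.
by rewrite andbF rmorph0 mulr0.
Qed.

Lemma l2n_std (i : 'I_n) : l2n (std_vec R i : vec).
Proof.
have [] // := @l2n_bound R G n (std_vec R i) 1.
move=> J; rewrite (bigD1 i) //= [X in _ + X]big1 ?addr0 => [|j /negbTE ji]; last first.
  by rewrite big1 // => g _; rewrite /std_vec ji sqabsE /= expr0n addr0.
apply: (@le_trans _ _ (\sum_(g <- J) 1 *+ (g == 1%g))).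
  apply: ler_sum => g _; rewrite /std_vec eqxx /=; case: eqP => _ /=.
    by rewrite sqabsE /= expr1n expr0n addr0.
  by rewrite sqabsE /= expr0n addr0.
apply: (@le_trans _ _ (\sum_(g <- (J `|` [fset 1%g])%fset) 1 *+ (g == 1%g))).
  by apply: le_sum_fset => [g|]; [case: eqP|exact: fsubsetUl].
rewrite (big_fsetD1 1%g) ?inE ?eqxx ?orbT //= big1_fset ?addr0 // => g.
by rewrite !inE => /andP[/negbTE ->].
Qed.

Lemma l2n_dot_std (x : vec) i : l2n_dot x (std_vec R i) = x i 1%g.
Proof.
rewrite /l2n_dot (bigD1 i) //= big1 ?addr0 => [|j ji].
  by have /l2_dotE := @std_vec_supp (x i) i i (x i 1%g) (fun=> erefl); rewrite eqxx.
have /l2_dotE -> := @std_vec_supp (x j) i j (x j 1%g) (fun=> erefl).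
by rewrite (negbTE ji).
Qed.

(** The orbit of the i-th basis vector consists of the i-th rows of the powers. *)
Lemma iter_rmul_std l i : iter l (rmul_op R B) (std_vec R i) =
  fun j g => (((B ^+ l) i j)@_g)%:~R.
Proof.
elim: l => [|l ih].
  apply/funext => j; apply/funext => g; rewrite expr0 mxE /= /std_vec.
  case: (eqVneq j i) => _; last by rewrite mcoeff0.
  by rewrite -[true%:R]/(gr1 G) /gr1 mcoeffU (eq_sym 1%g) /=; case: eqP.
apply/funext => j; apply/funext => g; rewrite iterS ih exprSr -[_ * _]/(_ *m _) mxE.
rewrite mcoeff_sum rmorph_sum; apply: eq_bigr => k _.
by rewrite mcoeffM rmorph_sum; apply: eq_bigr => h _; rewrite rmorphM.
Qed.

Definition ring_trace l : int := \sum_(i < n) ((B ^+ l) i i)@_1%g.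
Definition poly_trace (p : {poly R}) : R := \sum_(l < size p) p`_l * (ring_trace l)%:~R.

Lemma moment_std i p : moment (rmul_op R B) (std_vec R i) p =
  \sum_(l < size p) p`_l * (((B ^+ l) i i)@_1%g)%:~R.
Proof.
have L2 x : l2n x -> l2n (rmul_op R B x) by exact: l2n_rmul.
have le := l2n_std i.
have := l2n_poly_vec L2 (@rmulD R G n B) (@rmulZ R G n B) le p => lp.
apply: (@complexI R); rewrite -(momentC L2) //; last 3 first.
- exact: rmulD.
- exact: rmulZ.
- exact: rmul_sym.
rewrite (l2n_dotC lp) // l2n_dot_std /poly_vec rmorph_sum rmorph_sum /=.
apply: eq_bigr => l _; rewrite iter_rmul_std rmorphM rmorphM /=.
by rewrite [X in X * _]conjc_real intC_conj rmorph_int.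
Qed.

Lemma sum_moment_std p :
  \sum_(i < n) moment (rmul_op R B) (std_vec R i) p = poly_trace p.
Proof.
under eq_bigr do rewrite moment_std.
rewrite exchange_big; apply: eq_bigr => l _ /=.
by rewrite -mulr_sumr /ring_trace rmorph_sum.
Qed.

Variable c : R.
Hypothesis c_gt0 : 0 < c.
Hypothesis c_bnd : forall x : vec, l2n x -> sqnorm (rmul_op R B x) <= c * sqnorm x.

(** Two candidates for the projection differ by a vector of V orthogonal to V. *)
Lemma orth_projE (V : set vec) x y : V y -> (forall v, V v -> l2n v) -> l2n x ->
  (forall v w, V v -> V w -> V (v - w)) ->
  (forall v, V v -> l2n_dot (x - y) v = 0) -> orth_proj V x = y.
Proof.
move=> Vy Vl lx VB h; rewrite /orth_proj; case: xgetP => [y' _ [Vy' h']|/(_ y)]; last first.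
  by case; split.
have ly := Vl _ Vy; have ly' := Vl _ Vy'.
apply/eqP; rewrite -subr_eq0; apply/eqP/sqnorm_eq0; first exact: l2nB.
have E : (x - y) - (x - y') = y' - y by rewrite opprB addrC addrA subrK.
have lB := l2nB ly' ly; have VyB := VB _ _ Vy' Vy.
rewrite /sqnorm -{1}E l2n_dotBl ?h ?h' ?subrr //; exact: l2nB.
Qed.

(** Summing [kernel_projection] over the basis vectors replaces the projection by
    traces of polynomials. *)
Theorem b2_limit :
  [/\ (fun m => poly_trace (contr c ^+ m)) @ \oo --> b2 R B,
      forall h : {poly R}, h.[0] = 1 -> b2 R B <= poly_trace (h ^+ 2) &
      forall h : {poly R}, h.[0] = 1 -> b2 R B <= poly_trace (contr c * h ^+ 2)].
Proof.
have K i := kernel_projection (@l2n_rmul R G n B) (@rmulD R G n B) (@rmulZ R G n B)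
  rmul_sym c_gt0 c_bnd (l2n_std i).
pose y i := projT1 (cid (K i)); have yP i := projT2 (cid (K i)).
pose z i := projT1 (cid (yP i)); have zP i := projT2 (cid (yP i)).
have -> : b2 R B = \sum_(i < n) z i.
  rewrite /b2 /vN_dim raddf_sum /=; apply: eq_bigr => i _.
  case: (zP i) => ly ay orth ye _.
  rewrite (@orth_projE _ _ (y i)) ?ye //.
  - by move=> v [].
  - exact: l2n_std.
  - move=> v w [lv av] [lw aw]; split; first exact: l2nB.
    by rewrite -vscaleN1 rmulD rmulZ av aw vscaleN1 subr0.
  - by move=> v [lv av]; exact: orth.
split.
- under eq_cvg do rewrite -sum_moment_std.
  apply: cvg_big => [|i _]; first exact: add_continuous.
  by case: (zP i) => _ _ _ _ [].
- move=> h h0; rewrite -sum_moment_std; apply: ler_sum => i _.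
  by case: (zP i) => _ _ _ _ [_ H _]; exact: H.
- move=> h h0; rewrite -sum_moment_std; apply: ler_sum => i _.
  by case: (zP i) => _ _ _ _ [_ _ H]; exact: H.
Qed.

(** Diagonal coefficients of even powers are squared norms; this is the source of
    all positivity and growth bounds for the traces. *)
Lemma std_sqnorm_iter l i : sqnorm (iter l (rmul_op R B) (std_vec R i)) =
  (((B ^+ (l + l)) i i)@_1%g)%:~R.
Proof.
have li k : l2n (iter k (rmul_op R B) (std_vec R i)).
  by elim: k => [|k ih]; [exact: l2n_std|exact: l2n_rmul].
have E k m : l2n_dot (iter k (rmul_op R B) (std_vec R i))
    (iter m (rmul_op R B) (std_vec R i)) =
  l2n_dot (iter (m + k) (rmul_op R B) (std_vec R i)) (std_vec R i).
  elim: m k => [|m ih] k //; rewrite iterS -rmul_sym // -iterS ih.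
  by rewrite addnS addSn.
apply: (@complexI R); rewrite -sqnormC // E l2n_dot_std iter_rmul_std.
by rewrite rmorph_int.
Qed.

End Selfadjoint.

(** * Spectra of symmetric integer matrices *)

Section IntSym.
Variables (R : realType) (N : nat).

Lemma conj_diag_exp (P D : 'M[R[i]]_N) l : P \in unitmx ->
  (invmx P *m D *m P) ^+ l = invmx P *m (D ^+ l) *m P.
Proof.
move=> Pu; elim: l => [|l ih]; first by rewrite !expr0 mulmx1 mulVmx.
by rewrite !exprS ih -![_ * _]/(_ *m _) !mulmxA mulmxK.
Qed.

Lemma diag_mx_exp (d : 'rV[R[i]]_N) l :
  diag_mx d ^+ l = diag_mx (\row_i (d 0 i) ^+ l).
Proof.
elim: l => [|l ih].
  by apply/matrixP => i j; rewrite expr0 !mxE expr0.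
rewrite exprS ih -[_ * _]/(_ *m _) mul_diag_mx; apply/matrixP => i j.
by rewrite !mxE exprS -mulrnAr.
Qed.

Lemma char_poly_conj (P D : 'M[R[i]]_N) : P \in unitmx ->
  char_poly (invmx P *m D *m P) = char_poly D.
Proof.
move=> Pu; rewrite /char_poly /char_poly_mx.
have PuX : map_mx (@polyC R[i]) P \in unitmx by rewrite map_unitmx.
have -> : 'X%:M - map_mx (@polyC R[i]) (invmx P *m D *m P) =
    invmx (map_mx (@polyC R[i]) P) *m ('X%:M - map_mx (@polyC R[i]) D)
      *m map_mx (@polyC R[i]) P.
  rewrite mulmxBr mulmxBl !map_mxM map_invmx; congr (_ - _).
  by rewrite -mulmxA -scalar_mxC mulKmx.
by rewrite !det_mulmx mulrC mulrA -det_mulmx mulmxV // det1 mul1r.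
Qed.

(** The last claim is the arithmetic heart: the characteristic polynomial is X^z
    times a polynomial whose constant term is, up to sign, the product of the
    nonzero eigenvalues; this constant term is a nonzero integer. *)
Lemma int_symmetric_spectrum (M : 'M[int]_N) : M^T = M ->
  exists xs : seq R, [/\ size xs = N,
    forall l, (\tr (M ^+ l))%:~R = \sum_(x <- xs) x ^+ l &
    1 <= \prod_(x <- xs | x != 0) `|x|].
Proof.
move=> Msym; pose A : 'M[R[i]]_N := map_mx intr M.
have Asym : A \is symmetricmx.
  by apply/is_hermitianmxP; rewrite expr0 scale1r map_mx_id // /A map_trmx Msym.
have Areal : A \is a mxOver Num.real.
  by apply/mxOverP => i j; rewrite mxE realz.
have Aherm := realsym_hermsym Asym Areal.
have sp_real := hermitian_spectral_diag_real Aherm.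
have /orthomx_spectralP := hermitian_normalmx Aherm.
set P := spectralmx A; set sp := spectral_diag A => AE.
have Pu : P \in unitmx := spectral_unit A.
pose f i := complex.Re (sp 0 i).
have fE i : (f i)%:C%C = sp 0 i by apply: RRe_real; exact: (mxOverP sp_real).
exists [seq f i | i <- enum 'I_N]; split.
- by rewrite size_map size_enum_ord.
- move=> l; have AX : A ^+ l = map_mx intr (M ^+ l).
    elim: l => [|l ih]; first by rewrite !expr0 map_mx1.
    by rewrite !exprS ih -![_ * _]/(_ *m _) map_mxM.
  apply: (@complexI R); rewrite rmorph_int big_map big_enum /= [RHS]rmorph_sum /=.
  have -> : (\tr (M ^+ l))%:~R = \tr (A ^+ l).
    rewrite /A /mxtrace rmorph_sum; apply: eq_bigr => i _.
    by rewrite AX mxE.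
  rewrite AE conj_diag_exp // mxtrace_mulC mulmxA mulmxV // mul1mx diag_mx_exp.
  by rewrite mxtrace_diag; apply: eq_bigr => i _; rewrite mxE -fE rmorphXn.
- have cpE : map_poly intr (char_poly M) = \prod_(i < N) ('X - (sp 0 i)%:P).
    rewrite map_char_poly -/A AE char_poly_conj // char_poly_trig ?diag_mx_is_trig //.
    by apply: eq_bigr => i _; rewrite !mxE eqxx mulr1n.
  rewrite big_map big_enum_cond /=.
  pose z := #|[pred i | f i == 0]|.
  have := cpE; rewrite (bigID (fun i => f i == 0)) /=.
  have -> : \prod_(i < N | f i == 0) ('X - (sp 0 i)%:P) = 'X^z.
    rewrite (eq_bigr (fun=> 'X)) => [|i /eqP fi]; last by rewrite -fE fi subr0.
    by rewrite prodr_const.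
  set q := \prod_(i < N | f i != 0) _ => /(congr1 (fun p : {poly _} => p`_z)).
  rewrite coef_map coefXnM ltnn subnn -horner_coef0 /q horner_prod => cz.
  have : (1 : R[i]) <= `|((char_poly M)`_z)%:~R|.
    rewrite -intr_norm -[1]/(1%:~R) ler_int -gtz0_ge1 normr_gt0 -(intr_eq0 R[i]).
    rewrite cz prodf_seq_neq0; apply/allP => i _; apply/implyP => fi.
    by rewrite !hornerE oppr_eq0 -fE (inj_eq (@complexI R)).
  rewrite cz normr_prod -lecR rmorph_prod /= => /le_trans -> //.
  rewrite le_eqVlt; apply/orP; left; apply/eqP; apply: eq_bigr => i _.
  by rewrite !hornerE normrN -fE normc_def /= expr0n addr0 sqrtr_sqr.
Qed.

End IntSym.

(** * Finite groups and quotients *)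

Section FiniteGroup.
Variables (G : groupType) (n : nat) (F : {fset G}).
Hypothesis inF : forall g : G, g \in F.

Local Notation T := ('I_n * F)%type.

(** The matrix of right multiplication by [C] in the basis of group elements. *)
Definition regmx (C : 'M[groupRing G]_n) : 'M[int]_#|{: T}| :=
  \matrix_(a, b) (C (enum_val a).1 (enum_val b).1)@_
     ((val (enum_val a).2)^-1 * val (enum_val b).2)%g.

Lemma mcoeffM_fin (a b : groupRing G) g h :
  (a * b)@_(g^-1 * h)%g = \sum_(u : F) a@_(g^-1 * val u)%g * b@_((val u)^-1 * h)%g.
Proof.
rewrite mcoeffM -(big_seq_fsetE _ F xpredT (fun u => a@_(g^-1 * u)%g * b@_(u^-1 * h)%g)) /=.
have sF : (msupp b `<=` F)%fset by apply/fsubsetP => u _.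
rewrite (big_fset_incl _ sF) /=; last first.
  by move=> u _ /mcoeff_outdom ->; rewrite mulr0.
have {1}-> : F = [fset (u^-1 * h)%g | u in F]%fset.
  apply/fsetP => u; rewrite inF; apply/esym/imfsetP; exists (h * u^-1)%g => //=.
  by rewrite invgM invgK mulgVK.
rewrite big_imfset /=; last by move=> u v _ _ /mulIg/invg_inj.
by apply: eq_bigr => u _; rewrite invgM invgK !mulgA mulgK.
Qed.

Lemma sum_enum_pair (V : nmodType) (f : T -> V) :
  \sum_(a < #|{: T}|) f (enum_val a) = \sum_(i < n) \sum_(u : F) f (i, u).
Proof.
by rewrite -(big_enum_val (A := {: T})) pair_big /=; apply: eq_bigr => -[].
Qed.

Lemma regmxM C D : regmx (C * D) = regmx C * regmx D.
Proof.
apply/matrixP => a b; rewrite -[_ * regmx D]/(_ *m _) !mxE.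
under [RHS]eq_bigr do rewrite !mxE.
rewrite (sum_enum_pair (fun t : T => (C (enum_val a).1 t.1)@_((val (enum_val a).2)^-1 * val t.2)%g *
   (D t.1 (enum_val b).1)@_((val t.2)^-1 * val (enum_val b).2)%g)).
rewrite mcoeff_sum; apply: eq_bigr => i _; exact: mcoeffM_fin.
Qed.

Lemma mcoeff_one g : (1 : groupRing G)@_g = (g == 1%g)%:R.
Proof. by rewrite -[1]/(gr1 G) /gr1 mcoeffU eq_sym. Qed.

Lemma regmx1 : regmx 1 = 1.
Proof.
apply/matrixP => a b; rewrite !mxE.
have -> : (a == b) = ((enum_val a).1 == (enum_val b).1) &&
   ((val (enum_val a).2)^-1 * val (enum_val b).2 == 1)%g.
  rewrite -(inj_eq enum_val_inj) -pair_eqE /=; congr (_ && _).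
  by rewrite -(inj_eq val_inj) eq_sym -(inj_eq (mulgI (val (enum_val a).2)^-1)%g) mulVg.
by case: eqP => _ /=; rewrite ?mcoeff_one ?mcoeff0.
Qed.

Lemma regmxX C l : regmx (C ^+ l) = regmx C ^+ l.
Proof. by elim: l => [|l ih]; rewrite ?expr0 ?regmx1 // !exprS regmxM ih. Qed.

Lemma tr_regmx C : selfadjoint C -> (regmx C)^T = regmx C.
Proof.
move=> Csa; apply/matrixP => a b; rewrite !mxE selfadjoint_coeff //.
by rewrite invgM invgK.
Qed.

Lemma trace_regmx C : \tr (regmx C) = (\sum_(i < n) (C i i)@_1%g) *+ #|{: F}|.
Proof.
rewrite /mxtrace; under eq_bigr do rewrite !mxE mulVg.
rewrite (sum_enum_pair (fun t : T => (C t.1 t.1)@_1%g)) -sumrMnl.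
by apply: eq_bigr => i _; rewrite -sumr_const; apply: eq_bigl.
Qed.

End FiniteGroup.

(** The eigenvalues of the regular matrix; each coefficient at 1 is seen once for
    every group element, whence the factor 1/K. *)
Lemma finite_group_spectrum (R : realType) (G : groupType) n (B : 'M[groupRing G]_n) :
  finite_set [set: G] -> selfadjoint B ->
  exists (K : nat) (xs : seq R), [/\ (0 < K)%N, size xs = (n * K)%N,
    forall l, (ring_trace B l)%:~R = K%:R^-1 * \sum_(x <- xs) x ^+ l &
    1 <= \prod_(x <- xs | x != 0) `|x|].
Proof.
move=> /finite_fsetP[F FE] Bsa.
have inF g : g \in F by have : [set: G] g by []; rewrite FE.
have [xs [sxs trxs prodxs]] := int_symmetric_spectrum R (tr_regmx F Bsa).
have K0 : (0 < #|{: F}|)%N by apply/card_gt0P; exists [` inF 1%g ]%fset.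
exists #|{: F}|, xs; split => //; first by rewrite sxs card_prod card_ord.
move=> l; rewrite -trxs -regmxX // trace_regmx rmorphMn /= -[X in _ * X]mulr_natl mulKf //.
by rewrite pnatr_eq0 -lt0n.
Qed.

Section Quotient.
Variables (G : groupType) (N : normalSubgroup G) (n : nat).
Local Notation Q := (quotientGroup N).

Lemma qproj_mul (x y : G) : qproj N (x * y)%g = (qproj N x * qproj N y)%g.
Proof. by rewrite -qprojM. Qed.

Lemma qproj_inv (x : G) : qproj N x^-1%g = (qproj N x)^-1%g.
Proof. by rewrite -qprojV. Qed.

Lemma qproj_one : qproj N 1%g = 1%g.
Proof. by []. Qed.

Section Hom.
Variables (H : groupType) (f : G -> H).
Hypothesis fM : forall x y, f (x * y)%g = (f x * f y)%g.

Lemma groupRing_mapw (J : {fset G}) a : (msupp a `<=` J)%fset ->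
  groupRing_map f a = \sum_(g <- J) << a@_g *g f g >>.
Proof.
move=> aJ; rewrite /groupRing_map (big_fset_incl _ aJ) // => g _ /mcoeff_outdom ->.
by rewrite monalgU0.
Qed.

Lemma groupRing_mapD (a b : groupRing G) :
  groupRing_map f (a + b) = groupRing_map f a + groupRing_map f b.
Proof.
set J := (msupp a `|` msupp b)%fset.
rewrite (@groupRing_mapw J a) ?fsubsetUl // (@groupRing_mapw J b) ?fsubsetUr //.
rewrite (@groupRing_mapw J (a + b)) ?msuppD_le // -big_split.
by apply: eq_bigr => g _; rewrite mcoeffD monalgUD.
Qed.

Lemma groupRing_map0 : groupRing_map f 0 = 0.
Proof. by rewrite /groupRing_map msupp0 big_seq_fset0. Qed.

Lemma groupRing_map_sum (I : Type) (r : seq I) (a : I -> groupRing G) :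
  groupRing_map f (\sum_(i <- r) a i) = \sum_(i <- r) groupRing_map f (a i).
Proof.
elim: r => [|i r ih]; first by rewrite !big_nil groupRing_map0.
by rewrite !big_cons groupRing_mapD ih.
Qed.

Lemma groupRing_mapU k g : groupRing_map f << k *g g >> = << k *g f g >>.
Proof. by rewrite (groupRing_mapw msuppU_le) big_seq_fset1 mcoeffUU. Qed.

Lemma groupRing_mapM (a b : groupRing G) :
  groupRing_map f (a * b) = groupRing_map f a * groupRing_map f b.
Proof.
rewrite -[a * b]/(grmul a b) -[RHS]/(grmul _ _) {1}/grmul groupRing_map_sum.
rewrite {2}/groupRing_map grmul_suml; apply: eq_bigr => g _.
rewrite groupRing_map_sum [groupRing_map f b]/groupRing_map grmul_sumr.
by apply: eq_bigr => h _; rewrite groupRing_mapU grmulUU fM.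
Qed.

End Hom.

(** The coefficient at 1 of the image collects the coefficients on N, and by
    adaptedness only the one at 1 is nonzero. *)
Lemma mcoeff_quotient1 (a : groupRing G) :
  (forall g, g \in msupp a -> g = 1%g \/ g \notin N) ->
  (groupRing_map (@qproj G N) a)@_1%g = a@_1%g.
Proof.
move=> aN; rewrite mcoeff_map -[RHS](sum_mcoeff_eq 1%g (fsubset_refl _)).
apply: eq_big_seq => g ga; congr (_ *+ nat_of_bool _).
have [->|gN] := aN g ga; first by rewrite qproj_one !eqxx.
have -> : (g == 1%g) = false by apply/eqP => g1; rewrite g1 gpred1 in gN.
apply/eqP => /esym; rewrite -qproj_one => /qprojP; rewrite invg1 mul1g => gN'.
by rewrite gN' in gN.
Qed.

Lemma quotient_mxX (A : 'M[groupRing G]_n) l :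
  quotient_mx N (A ^+ l) = quotient_mx N A ^+ l.
Proof.
elim: l => [|l ih].
  apply/matrixP => i j; rewrite !expr0 !mxE.
  case: (i == j) => /=; last by rewrite groupRing_map0.
  by rewrite -[true%:R]/(gr1 G) /gr1 groupRing_mapU.
rewrite !exprS -ih; apply/matrixP => i j; rewrite -![_ * _]/(_ *m _) !mxE.
rewrite groupRing_map_sum; apply: eq_bigr => k _.
by rewrite !mxE groupRing_mapM //; exact: qproj_mul.
Qed.

Lemma selfadjoint_quotient (A : 'M[groupRing G]_n) :
  selfadjoint A -> selfadjoint (quotient_mx N A).
Proof.
move=> Asa; apply/matrixP => i j; rewrite !mxE; apply/malgP => q.
rewrite mcoeff_star !mcoeff_map msupp_selfadjoint // big_imfset /=; last first.
  by move=> g h _ _; exact: invg_inj.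
apply: eq_bigr => g _; rewrite selfadjoint_coeff // invgK qproj_inv.
by rewrite -(inj_eq invg_inj) invgK.
Qed.

Lemma ring_trace_quotient (A : 'M[groupRing G]_n) l :
  (forall i g, g \in msupp ((A ^+ l) i i) -> g = 1%g \/ g \notin N) ->
  ring_trace (quotient_mx N A) l = ring_trace A l.
Proof.
move=> AN; rewrite /ring_trace -quotient_mxX; apply: eq_bigr => i _.
by rewrite mxE mcoeff_quotient1 //; exact: AN.
Qed.

End Quotient.

(** * Fejér kernels against the logarithm *)

(** With s = sin^2 t, the pair is sin ((2r+1) t) / sin t and
    cos ((2r+1) t) / cos t, as polynomials in s; the recursion is the rotation by
    2t.  It is defined over any ring in order to be both evaluated and used as a
    polynomial. *)
Fixpoint cheb (A : nzRingType) (s : A) (r : nat) : A * A :=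
  if r is r'.+1 then
    let: (w, v) := cheb s r' in
    ((1 - 2%:R * s) * w + 2%:R * (1 - s) * v, (1 - 2%:R * s) * v - 2%:R * s * w)
  else (1, 1).

Lemma chebS (A : nzRingType) (s : A) r : cheb s r.+1 =
    ((1 - 2%:R * s) * (cheb s r).1 + 2%:R * (1 - s) * (cheb s r).2,
     (1 - 2%:R * s) * (cheb s r).2 - 2%:R * s * (cheb s r).1).
Proof. by rewrite /=; case: (cheb s r). Qed.

Lemma rmorph_cheb (A B : nzRingType) (f : {rmorphism A -> B}) (s : A) r :
  (cheb (f s) r) = (f (cheb s r).1, f (cheb s r).2).
Proof.
elim: r => [|r ih]; first by rewrite /= rmorph1.
by rewrite !chebS ih /= !(rmorphD, rmorphN, rmorphM, rmorph_nat, rmorph1).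
Qed.

Section Cheb.
Variable R : realType.
Implicit Types (s t : R) (r : nat).

Lemma cheb0 r : cheb (0 : R) r = ((r.*2.+1)%:R, 1).
Proof.
elim: r => [|r ih] //; rewrite chebS ih /= !mulr0 !subr0 mulr1 mul0r subr0 !mul1r.
by rewrite mulr1 -natrD addn2 doubleS.
Qed.

(** Pythagoras for the angle (2r+1) t. *)
Lemma cheb_pell s r : s * (cheb s r).1 ^+ 2 + (1 - s) * (cheb s r).2 ^+ 2 = 1.
Proof.
elim: r => [|r ih]; first by rewrite /=; ring.
by rewrite chebS /= -[RHS]ih; ring.
Qed.

Lemma cheb_sw_le1 s r : 0 <= s <= 1 -> s * (cheb s r).1 ^+ 2 <= 1.
Proof.
move=> /andP[s0 s1]; have := cheb_pell s r.
have : 0 <= (1 - s) * (cheb s r).2 ^+ 2 by rewrite mulr_ge0 ?sqr_ge0 ?subr_ge0.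
lra.
Qed.

(** The increments sin ((2r+3) t) - sin ((2r+1) t) are 2 sin t cos ((2r+2) t). *)
Lemma cheb_w_le s r : 0 <= s <= 1 -> `|(cheb s r).1| <= (r.*2.+1)%:R.
Proof.
move=> s01; have /andP[s0 s1] := s01.
elim: r => [|r ih]; first by rewrite normr1.
set w := (cheb s r).1 in ih *; set v := (cheb s r).2.
have E : (cheb s r.+1).1 = w + 2 * ((1 - s) * v - s * w) by rewrite chebS /= -/w -/v; ring.
have c : `|(1 - s) * v - s * w| <= 1.
  rewrite -(@ler_pXn2r _ 2) ?nnegrE // real_normK ?num_real // expr1n.
  rewrite -[leRHS](cheb_pell s r) -/w -/v -subr_ge0.
  have -> : s * w ^+ 2 + (1 - s) * v ^+ 2 - ((1 - s) * v - s * w) ^+ 2 =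
    s * (1 - s) * (w + v) ^+ 2 by ring.
  by rewrite mulr_ge0 ?sqr_ge0 // mulr_ge0 // subr_ge0.
rewrite E (le_trans (ler_normD _ _)) // normrM ger0_norm //.
have -> : (r.+1.*2.+1)%:R = (r.*2.+1)%:R + 2 :> R by rewrite doubleS -addn2 natrD.
lra.
Qed.

(** Beyond s = 1 the trigonometric functions become hyperbolic; the linear lower
    bound is the tangent at s = 1. *)
Lemma cheb_ge t r : 0 <= t ->
  1 + 2 * (r * r.+1)%:R * t <= (-1) ^+ r * (cheb (1 + t) r).1 /\
  (r.*2.+1)%:R <= (-1) ^+ r * (cheb (1 + t) r).2.
Proof.
move=> t0; elim: r => [|r [ihw ihv]].
  by rewrite mul0n mulr0 mul0r addr0 expr0 !mul1r.
rewrite chebS exprS /=; set w := (-1) ^+ r * _ in ihw; set v := (-1) ^+ r * _ in ihv.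
set w0 := (cheb _ _).1 in w ihw *; set v0 := (cheb _ _).2 in v ihv *.
have -> : -1 * (-1) ^+ r * ((1 - 2 * (1 + t)) * w0 + 2 * (1 - (1 + t)) * v0) =
  (1 + 2 * t) * w + 2 * t * v by rewrite /w /v; ring.
have -> : -1 * (-1) ^+ r * ((1 - 2 * (1 + t)) * v0 - 2 * (1 + t) * w0) =
  (1 + 2 * t) * v + 2 * (1 + t) * w by rewrite /w /v; ring.
have r0 : 0 <= r%:R :> R by [].
have E (k : nat) : k.+1%:R = k%:R + 1 :> R by rewrite natr1.
move: ihw ihv; rewrite -!muln2 !(E (_ * 2)%N) !natrM (E r.+1) (E r).
set x := r%:R in r0 *; move: w v => w v ihw ihv.
have x1 : 0 <= x * (x + 1) * t by rewrite mulr_ge0 // mulr_ge0 // addr_ge0.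
have w1 : 1 <= w by lra.
have h1 : 0 <= (w - (1 + 2 * (x * (x + 1)) * t)) * t by rewrite mulr_ge0 // subr_ge0.
have h2 : 0 <= (v - (x * 2 + 1)) * t by rewrite mulr_ge0 // subr_ge0.
have h3 : 0 <= x * (x + 1) * t * t by rewrite mulr_ge0.
have h4 : 0 <= v * t by rewrite mulr_ge0 //; lra.
have h5 : 0 <= (w - 1) * t by rewrite mulr_ge0 // subr_ge0.
split; lra.
Qed.

Lemma cheb_growth s r : 1 <= s ->
  `|(cheb s r).1| <= (4 * s) ^+ r /\ `|(cheb s r).2| <= (4 * s) ^+ r.
Proof.
move=> s1; elim: r => [|r [ihw ihv]]; first by rewrite !normr1 expr0.
rewrite chebS exprS /=; set w := (cheb s r).1 in ihw *; set v := (cheb s r).2 in ihv *.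
set M := _ ^+ r in ihw ihv *.
have M0 : 0 <= M by apply: le_trans ihw.
have bw : (2 * s) * `|w| <= (2 * s) * M by rewrite ler_wpM2l //; lra.
have bv : (2 * s) * `|v| <= (2 * s) * M by rewrite ler_wpM2l //; lra.
have w0 := normr_ge0 w; have v0 := normr_ge0 v.
have a1 (x : R) : `|(1 - 2 * s) * x| = (2 * s - 1) * `|x|.
  by rewrite normrM ler0_norm ?opprB //; lra.
have a2 (x : R) : `|2 * (1 - s) * x| = (2 * s - 2) * `|x|.
  by rewrite normrM ler0_norm; lra.
have a3 (x : R) : `|2 * s * x| = 2 * s * `|x|.
  by rewrite normrM ger0_norm; lra.
split; apply: (le_trans (ler_normD _ _)); rewrite ?normrN a1 ?a2 ?a3; lra.
Qed.

Lemma expR_chord (T l : R) : 0 <= l <= 1 -> expR (- (l * T)) <= 1 - l + l * expR (- T).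
Proof.
move=> l01; have := convex_expR (Itv01 (andP l01).1 (andP l01).2) (- T) 0.
rewrite !convRE /= /onem mulr0 addr0 expR0 mulr1 mulrN.
by rewrite addrC.
Qed.

(** The bound behind both certificates.  Put l = 1 + log s / log m^2, so that
    l = 0 at s = 1/m^2 and l = 1 at s = 1.  There 1/(m^2 s) = exp (- l log m^2)
    lies below its chord, and the weight of the logarithm is chosen so that the
    logarithm cancels the chord up to rho. *)
Lemma cert_core (m s rho kap a : R) : 1 < m -> 0 < s <= 1 -> 0 <= rho <= 1 ->
  0 <= kap -> (m ^+ 2)^-1 - kap <= rho ->
  a <= 1 -> a <= (m ^+ 2 * s)^-1 - kap ->
  a + (1 - rho) / (2 * ln m) * ln s <= rho.
Proof.
move=> m1 /andP[s0 s1] /andP[r0 r1] k0 kr a1 a2.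
have M0 : 0 < ln m by rewrite ln_gt0.
have m0 : 0 < m by lra.
set lam := _ / _; have lamE : lam * (2 * ln m) = 1 - rho.
  by rewrite /lam divfK // gt_eqF // mulr_gt0.
have lam0 : 0 <= lam by rewrite divr_ge0 ?subr_ge0 // mulr_ge0 // ltW.
have m20 : 0 < m ^+ 2 by rewrite exprn_gt0.
have lnm2 : ln (m ^+ 2)^-1 = - (2 * ln m).
  by rewrite lnV ?posrE // lnXn // mulr_natl.
have [sm|ms] := leP s (m ^+ 2)^-1.
  have : lam * ln s <= lam * (- (2 * ln m)).
    by rewrite ler_wpM2l // -lnm2 ler_ln // posrE invr_gt0.
  lra.
have lns0 : ln s <= 0 by rewrite ln_le0.
have lns1 : - (2 * ln m) <= ln s.
  by rewrite -lnm2 ler_ln ?posrE ?invr_gt0 // ltW.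
pose l := 1 + ln s / (2 * ln m).
have lE : l * (2 * ln m) = 2 * ln m + ln s by rewrite /l mulrDl mul1r divfK // gt_eqF // mulr_gt0.
have l01 : 0 <= l <= 1.
  apply/andP; split; rewrite /l; last by rewrite gerDl ler_pdivrMr ?mul0r // mulr_gt0.
  by rewrite -lerBlDl sub0r ler_pdivlMr ?mulN1r // mulr_gt0.
have := expR_chord (2 * ln m) l01; rewrite lE.
have -> : expR (- (2 * ln m + ln s)) = (m ^+ 2 * s)^-1.
  rewrite opprD -lnm2 -lnV ?posrE // expRD !lnK ?posrE ?invr_gt0 //.
  by rewrite [RHS]invfM.
rewrite -lnm2 lnK ?posrE ?invr_gt0 // => ch.
have -> : lam * ln s = - ((1 - rho) * (1 - l)).
  have -> : ln s = (l - 1) * (2 * ln m) by rewrite mulrBl lE mul1r addrAC subrr add0r.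
  by rewrite mulrCA lamE; ring.
have /andP[l0 l1] := l01.
have h1 : 0 <= (1 - l) * kap by rewrite mulr_ge0 // subr_ge0.
have h2 : l * ((m ^+ 2)^-1 - kap) <= l * rho by rewrite ler_wpM2l.
lra.
Qed.

(** The square root of the Fejér kernel in the variable x, where s = x^2/D; its
    value at 0 is 1. *)
Definition fejer_poly (D : R) r : {poly R} :=
  (r.*2.+1)%:R^-1 *: (cheb (D^-1 *: 'X^2) r).1.
Definition fejer s r : R := ((cheb s r).1 / (r.*2.+1)%:R) ^+ 2.

Lemma horner_cheb (p : {poly R}) x r :
  (cheb p r).1.[x] = (cheb p.[x] r).1 /\ (cheb p r).2.[x] = (cheb p.[x] r).2.
Proof. by rewrite -!horner_evalE rmorph_cheb. Qed.

Lemma horner_fejer_poly D r x : (fejer_poly D r).[x] = (cheb (x ^+ 2 / D) r).1 / (r.*2.+1)%:R.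
Proof.
by rewrite /fejer_poly hornerZ (horner_cheb _ _ _).1 hornerZ hornerXn mulrC (mulrC D^-1).
Qed.

Lemma horner_fejer_poly_sqr D r x : (fejer_poly D r ^+ 2).[x] = fejer (x ^+ 2 / D) r.
Proof. by rewrite horner_exp horner_fejer_poly. Qed.

Lemma horner_fejer_poly0 D r : (fejer_poly D r).[0] = 1.
Proof. by rewrite horner_fejer_poly expr0n mul0r cheb0 divff // pnatr_eq0. Qed.

Lemma size_cheb (p : {poly R}) r : (size p <= 3)%N ->
  (size (cheb p r).1 <= r.*2.+1)%N /\ (size (cheb p r).2 <= r.*2.+1)%N.
Proof.
move=> sp; have s2 : (size (2%:R : {poly R}) <= 1)%N.
  by rewrite -polyC_natr size_polyC_leq1.
have szM a b (u v : {poly R}) : (size u <= a.+1)%N -> (size v <= b)%N ->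
    (size (u * v)%R <= a + b)%N.
  move=> ua vb; have := size_polyMleq u v; lia.
have szB a (u v : {poly R}) : (size u <= a)%N -> (size v <= a)%N -> (size (u - v)%R <= a)%N.
  by move=> ua va; rewrite (leq_trans (size_polyD _ _)) // geq_max ua size_polyN.
have s2p : (size (2%:R * p)%R <= 3)%N by apply: (@szM 0%N).
have s12p : (size (1 - 2%:R * p)%R <= 3)%N.
  by apply: szB => //; rewrite size_poly1.
have s1p : (size (2%:R * (1 - p))%R <= 3)%N.
  by apply: (@szM 0%N) => //; apply: szB => //; rewrite size_poly1.
elim: r => [|r [ihw ihv]]; first by rewrite /= size_poly1.
have -> : r.+1.*2.+1 = (2 + r.*2.+1)%N by rewrite doubleS.
rewrite chebS; split; last by apply: szB; apply: szM.
by rewrite (leq_trans (size_polyD _ _)) // geq_max !szM.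
Qed.

Lemma size_fejer_poly D r : (size (fejer_poly D r) <= r.*2.+1)%N.
Proof.
rewrite /fejer_poly (leq_trans (size_scale_leq _ _)) // (size_cheb _ _).1 //.
by rewrite (leq_trans (size_scale_leq _ _)) // size_polyXn.
Qed.

Lemma size_fejer_poly_sqr D r : (size (fejer_poly D r ^+ 2) <= (4 * r).+1)%N.
Proof.
rewrite (leq_trans (size_poly_exp_leq _ _)) // ltnS mulnC.
have := size_fejer_poly D r; move: (size _) => k; lia.
Qed.

Lemma fejer_le1 s r : 0 <= s <= 1 -> fejer s r <= 1.
Proof.
move=> s01; rewrite /fejer expr_div_n ler_pdivrMr ?exprn_gt0 // mul1r.
by rewrite -real_normK ?num_real // ler_pXn2r ?nnegrE // cheb_w_le.
Qed.

Lemma fejer_le_inv s r : 0 < s <= 1 -> fejer s r <= ((r.*2.+1)%:R ^+ 2 * s)^-1.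
Proof.
move=> /andP[s0 s1]; rewrite /fejer expr_div_n ler_pdivrMr ?exprn_gt0 //.
rewrite invfM mulrAC mulVf ?mul1r; last by rewrite expf_neq0 // pnatr_eq0.
by rewrite -[s^-1]mul1r ler_pdivlMr // mulrC cheb_sw_le1 // s1 ltW.
Qed.

Lemma fejer_ge0 s r : 0 <= fejer s r.
Proof. exact: sqr_ge0. Qed.

(** For s > 1 nothing better than a high power of s is claimed: that term is
    absorbed by the moments of A. *)
Lemma fejer_log_le s r l (m : R := (r.*2.+1)%:R) (rho := (m ^+ 2)^-1)
    (lam := (1 - rho) / (2 * ln m)) :
  (0 < r)%N -> 0 < s -> (r.*2 < l)%N ->
  fejer s r + lam * ln s <= rho + (16 ^+ r + lam) * s ^+ l.
Proof.
move=> r0 s0 rl.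
have m1 : 1 < m by rewrite /m ltr1n ltnS double_gt0.
have m0 : 0 < m by lra.
have rho01 : 0 <= rho <= 1.
  apply/andP; split; first by rewrite /rho invr_ge0 exprn_ge0 // ltW.
  by rewrite /rho invf_cp1 ?exprn_gt0 // exprn_ege1 // ltW.
have lam0 : 0 <= lam.
  by rewrite divr_ge0 ?subr_ge0 ?(andP rho01).2 // mulr_ge0 // ltW // ln_gt0.
have [s1|s1] := leP s 1.
  have h : fejer s r + lam * ln s <= rho.
    apply: (@cert_core m s rho 0) => //; rewrite ?s0 ?subr0 //.
      by rewrite fejer_le1 // s1 ltW.
    by rewrite fejer_le_inv // s0.
  by rewrite (le_trans h) // lerDl mulr_ge0 ?exprn_ge0 ?addr_ge0 ?exprn_ge0 // ltW.
have q1 : fejer s r <= 16 ^+ r * s ^+ l.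
  rewrite /fejer expr_div_n ler_pdivrMr ?exprn_gt0 //.
  apply: (@le_trans _ _ (16 ^+ r * s ^+ l)); last first.
    rewrite ler_peMr ?exprn_ege1 ?mulr_ge0 ?exprn_ge0 ?ltW //.
  apply: (@le_trans _ _ (((4 * s) ^+ r) ^+ 2)).
    rewrite -real_normK ?num_real // ler_pXn2r ?nnegrE ?exprn_ge0 ?mulr_ge0 ?(ltW s0) //.
    exact: (cheb_growth r (ltW s1)).1.
  have -> : ((4 * s) ^+ r) ^+ 2 = 16 ^+ r * s ^+ r.*2.
    rewrite exprAC (_ : (4 * s) ^+ 2 = 16 * s ^+ 2); last by ring.
    by rewrite exprMn -exprM mul2n.
  by rewrite ler_wpM2l ?exprn_ge0 // (ler_weXn2l (ltW s1) (ltnW rl)).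
have q2 : lam * ln s <= lam * s ^+ l.
  rewrite ler_wpM2l // (le_trans (ltW (ln_sublinear s0))) //.
  by rewrite -{1}[s]expr1 ler_weXn2l ?ltW // (leq_ltn_trans _ rl).
have r0' := (andP rho01).1.
lra.
Qed.

(** For s = 1 + t > 1 the kernel is at least 16 t / 9, so the negative term beats
    the logarithm up to the maximum of lam t - 16 t^2 / 9, that is
    9 lam^2 / 64 <= 9 / (256 log^2 m).  This is where the lower bound on rho comes
    from. *)
Lemma fejer_contr_log_le s r rho (m : R := (r.*2.+1)%:R) :
  (0 < r)%N -> 0 < s ->
  9 / 256 / ln m ^+ 2 <= rho <= 1 ->
  (1 - s) * fejer s r + (1 - rho) / (2 * ln m) * ln s <= rho.
Proof.
move=> r0 s0 /andP[rho0 rho1].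
have m3 : 3 <= m by rewrite /m (ler_nat _ 3) ltnS -(leq_double 1) in r0 *.
have m1 : 1 < m by lra.
have m0 : 0 < m by lra.
have M0 : 0 < ln m by rewrite ln_gt0.
have rhop : 0 <= rho.
  by apply: le_trans rho0; rewrite divr_ge0 ?divr_ge0 // exprn_ge0 // ltW.
have q0 := fejer_ge0 s r.
have [s1|s1] := leP s 1.
  apply: (@cert_core m s rho (m ^+ 2)^-1) => //; rewrite ?s0 ?s1 ?rhop ?rho1 //.
  - by rewrite invr_ge0 exprn_ge0 // ltW.
  - by rewrite subrr.
  - have h : fejer s r <= 1 by rewrite fejer_le1 // s1 ltW.
    have : 0 <= s * fejer s r by rewrite mulr_ge0 // ltW.
    lra.
  - have -> : (m ^+ 2 * s)^-1 - (m ^+ 2)^-1 = (1 - s) * (m ^+ 2 * s)^-1.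
      by field; rewrite !gt_eqF.
    by rewrite ler_wpM2l ?subr_ge0 // fejer_le_inv // s0.
set lam := _ / _.
pose t := s - 1; have t0 : 0 < t by rewrite subr_gt0.
have lam0 : 0 <= lam by rewrite divr_ge0 ?subr_ge0 // mulr_ge0 // ltW.
have lnst : lam * ln s <= lam * t.
  by rewrite ler_wpM2l // -{1}(subrK 1 s) addrC le_ln1Dx // -/t; lra.
have qt : 16 / 9 * t <= fejer s r.
  have [wge _] := cheb_ge r (ltW t0); rewrite -(addrC (s - 1)) subrK in wge.
  pose b : R := (r * r.+1)%:R.
  have bE : 4 * b = m ^+ 2 - 1.
    rewrite /b /m -muln2 -!natr1 !natrM -natr1; ring.
  have b0 : 0 <= b by [].
  have bt0 : 0 <= b * t by rewrite mulr_ge0 // ltW.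
  have w2 : (1 + 2 * b * t) ^+ 2 <= (cheb s r).1 ^+ 2.
    have <- : ((-1) ^+ r * (cheb s r).1) ^+ 2 = (cheb s r).1 ^+ 2.
      by rewrite exprMn sqrr_sign mul1r.
    rewrite ler_pXn2r ?nnegrE //; first by lra.
    by rewrite (le_trans _ wge) // -/b -/t; lra.
  rewrite /fejer expr_div_n ler_pdivlMr ?exprn_gt0 // (le_trans _ w2) //.
  have m9 : 0 <= (m ^+ 2 - 9) * t.
    rewrite mulr_ge0 ?(ltW t0) // subr_ge0.
    have -> : 9 = 3 ^+ 2 :> R by ring.
    by rewrite ler_pXn2r ?nnegrE ?(ltW m0).
  have := sqr_ge0 (1 - 2 * b * t).
  have E : b * t = (m ^+ 2 - 1) / 4 * t by rewrite -bE; field.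
  have -> : (1 + 2 * b * t) ^+ 2 = (1 - 2 * b * t) ^+ 2 + 8 * (b * t) by ring.
  by rewrite E; lra.
have h1 : t * (16 / 9 * t) <= t * fejer s r by rewrite ler_wpM2l // ltW.
have h2 : lam ^+ 2 <= 1 / 4 / ln m ^+ 2.
  have -> : 1 / 4 / ln m ^+ 2 = (1 / (2 * ln m)) ^+ 2 by field; rewrite gt_eqF.
  rewrite ler_pXn2r ?nnegrE // ?divr_ge0 // ?mulr_ge0 ?(ltW M0) //.
  by rewrite /lam ler_pM2r ?invr_gt0 ?mulr_gt0 // gerBl.
have h3 : 9 / 256 / ln m ^+ 2 = 9 / 64 * (1 / 4 / ln m ^+ 2) by field; rewrite gt_eqF.
(* completes the square in lam t - 16 t^2 / 9 *)
have := sqr_ge0 (4 / 3 * t - 3 / 8 * lam).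
have -> : (4 / 3 * t - 3 / 8 * lam) ^+ 2 = t * (16 / 9 * t) - lam * t + 9 / 64 * lam ^+ 2.
  by field.
have -> : (1 - s) * fejer s r = - (t * fejer s r) by rewrite /t; ring.
lra.
Qed.

End Cheb.

(** * Eigenvalue counting *)

Section Count.
Variables (R : realType) (xs : seq R).
Hypothesis prod_ge1 : 1 <= \prod_(x <- xs | x != 0) `|x|.
Definition nzeros : nat := count (fun x => x == 0) xs.

Lemma sum_ln_ge0 : 0 <= \sum_(x <- xs | x != 0) ln (x ^+ 2).
Proof.
suff H (s : seq R) : 0 < \prod_(x <- s | x != 0) `|x| /\
    \sum_(x <- s | x != 0) ln (x ^+ 2) = 2 * ln (\prod_(x <- s | x != 0) `|x|).
  by rewrite (H xs).2 mulr_ge0 // ln_ge0.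
elim: s => [|x s [p0 ih]]; first by rewrite !big_nil ln1 mulr0.
rewrite !big_cons; case: ifP => // x0.
rewrite mulr_gt0 ?normr_gt0 //; split => //.
rewrite [ln (`|x| * _)]lnM ?posrE ?normr_gt0 // ih -real_normK ?num_real // lnXn ?normr_gt0 //.
by rewrite mulrDr -[_ *+ 2]mulr_natl.
Qed.

Lemma sum_split (f : R -> R) :
  \sum_(x <- xs) f x = f 0 * nzeros%:R + \sum_(x <- xs | x != 0) f x.
Proof.
rewrite (bigID (fun x => x == 0)) /=; congr (_ + _).
rewrite (eq_bigr (fun=> f 0)) => [|x /eqP -> //].
by rewrite big_const_seq iter_addr_0 mulr_natr.
Qed.

(** The use of the determinant bound: adding lam log x^2 to f can only increase
    the sum over the nonzero eigenvalues. *)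
Lemma sum_le_zeros (f g : R -> R) (lam F : R) : 0 <= lam -> 0 <= F ->
  (forall x, 0 <= g x) ->
  (forall x, x != 0 -> f x + lam * ln (x ^+ 2) <= F + g x) ->
  \sum_(x <- xs) f x <= f 0 * nzeros%:R + F * (size xs)%:R + \sum_(x <- xs) g x.
Proof.
move=> lam0 F0 g0 h; rewrite sum_split -addrA lerD2l.
have h1 : \sum_(x <- xs | x != 0) f x <=
    \sum_(x <- xs | x != 0) (F + g x - lam * ln (x ^+ 2)).
  by apply: ler_sum => x /h; rewrite lerBrDr.
have h2 := mulr_ge0 lam0 sum_ln_ge0.
rewrite big_split /= sumrN -mulr_sumr in h1.
have : \sum_(x <- xs | x != 0) (F + g x) <= \sum_(x <- xs) (F + g x).
  rewrite [leRHS](bigID (fun x => x == 0)) /= lerDr sumr_ge0 // => x _.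
  by rewrite addr_ge0.
rewrite [leRHS]big_split /= big_const_seq count_predT iter_addr_0 mulr_natr.
lra.
Qed.

Lemma zeros_le_sum (f : R -> R) : f 0 = 1 -> (forall x, 0 <= f x) ->
  nzeros%:R <= \sum_(x <- xs) f x.
Proof. by move=> f0 f_ge0; rewrite sum_split f0 mul1r lerDl sumr_ge0. Qed.

End Count.

Section Traces.
Variables (R : realType) (G : groupType) (n : nat) (B : 'M[groupRing G]_n).

Definition trace_sums (K : nat) (xs : seq R) (M : nat) := forall l, (l <= M)%N ->
  (ring_trace B l)%:~R = K%:R^-1 * \sum_(x <- xs) x ^+ l.

Lemma poly_trace_sums K xs M (p : {poly R}) : trace_sums K xs M -> (size p <= M.+1)%N ->
  poly_trace B p = K%:R^-1 * \sum_(x <- xs) p.[x].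
Proof.
move=> h sp; under [in RHS]eq_bigr do rewrite horner_coef.
rewrite exchange_big /= mulr_sumr; apply: eq_bigr => l _.
rewrite h; last by rewrite -ltnS (leq_trans (ltn_ord l)).
by rewrite -mulr_sumr mulrCA.
Qed.

Lemma size_contrX (c : R) m : (size (contr c ^+ m) <= (m.*2).+1)%N.
Proof.
have s3 : (size (contr c) <= 3)%N.
  rewrite /contr (leq_trans (size_polyD _ _)) // geq_max size_poly1 /= size_polyN.
  by rewrite (leq_trans (size_scale_leq _ _)) // size_polyXn.
rewrite (leq_trans (size_poly_exp_leq _ _)) // ltnS -mul2n leq_mul //.
by case: (size _) s3.
Qed.

Lemma horner_contr (c x : R) : (contr c).[x] = 1 - x ^+ 2 / c.
Proof. by rewrite /contr hornerD hornerN hornerZ hornerXn hornerC mulrC. Qed.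

Lemma zeros_le_poly_trace_contr K xs M (c : R) l : trace_sums K xs M -> (4 * l <= M)%N ->
  K%:R^-1 * (nzeros xs)%:R <= poly_trace B (contr c ^+ l.*2).
Proof.
move=> h lM; rewrite (poly_trace_sums h); last first.
  by rewrite (leq_trans (size_contrX _ _)) // ltnS -!mul2n mulnA.
rewrite ler_wpM2l ?invr_ge0 //; apply: zeros_le_sum.
  by rewrite horner_exp horner_contr expr0n mul0r subr0 expr1n.
by move=> x; rewrite horner_exp -mul2n exprM exprAC sqr_ge0.
Qed.

(** The trace of (1 - X^2/c)^m counts the zero eigenvalues in the limit. *)
Lemma b2_finite K xs : selfadjoint B -> (forall M, trace_sums K xs M) ->
  b2 R B = K%:R^-1 * (nzeros xs)%:R.
Proof.
move=> Bsa h; set d := op_norm (rmul_op R B).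
(* exceeds the squared norm of B and all squared eigenvalues *)
pose c := d ^+ 2 + 1 + \sum_(x <- xs) x ^+ 2.
have S0 : 0 <= \sum_(x <- xs) x ^+ 2 by rewrite sumr_ge0 // => x _; exact: sqr_ge0.
have d0 := sqr_ge0 d.
have c0 : 0 < c by rewrite /c; lra.
have cb (x : 'I_n -> G -> R[i]) : l2n x -> sqnorm (rmul_op R B x) <= c * sqnorm x.
  move=> lx; apply: le_trans (op_norm_le B lx) _.
  by rewrite ler_wpM2r ?sqnorm_ge0 // /c -/d; lra.
have [cv _ _] := b2_limit Bsa c0 cb.
have cv' : (fun m => poly_trace B (contr c ^+ m)) @ \oo --> (K%:R^-1 * (nzeros xs)%:R : R).
  have -> : (fun m => poly_trace B (contr c ^+ m)) =
      (fun m => K%:R^-1 * \sum_(x <- xs) (1 - x ^+ 2 / c) ^+ m).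
    apply/funext => m; rewrite (poly_trace_sums (h _) (size_contrX c m)).
    by congr (_ * _); apply: eq_bigr => x _; rewrite horner_exp horner_contr.
  apply: cvgM; first exact: cvg_cst.
  have -> : (nzeros xs)%:R = \sum_(x <- xs) (x == 0)%:R :> R.
    by rewrite /nzeros -sum1_count natr_sum big_mkcond; apply: eq_bigr => x _; case: ifP.
  rewrite big_seq; under eq_cvg do rewrite big_seq.
  apply: cvg_big => [|x xxs]; first exact: add_continuous.
  have [->|x0] := eqVneq x 0.
    by under eq_cvg do rewrite expr0n mul0r subr0 expr1n; exact: cvg_cst.
  apply: cvg_expr.
  have xc : x ^+ 2 < c.
    rewrite /c (big_rem x) //=.
    have : 0 <= \sum_(y <- rem x xs) y ^+ 2 by rewrite sumr_ge0 // => y _; exact: sqr_ge0.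
    lra.
  have h1 : 0 < x ^+ 2 / c by rewrite divr_gt0 // exprn_even_gt0.
  have h2 : x ^+ 2 / c < 1 by rewrite ltr_pdivrMr // mul1r.
  by rewrite ltr_norml; lra.
by rewrite -(cvg_lim _ cv) // (cvg_lim _ cv').
Qed.

End Traces.

Section Moments.
Variables (R : realType) (G : groupType) (n : nat) (A : 'M[groupRing G]_n).
Hypothesis Asa : selfadjoint A.
Local Notation d := (op_norm (rmul_op R A)).

Lemma sqnorm_std i : sqnorm (std_vec R i : 'I_n -> G -> R[i]) = 1.
Proof.
have := std_sqnorm_iter R Asa 0 i; rewrite /= expr0 mxE eqxx.
by rewrite -[true%:R]/(gr1 G) /gr1 mcoeffU eqxx.
Qed.

Lemma l2n_iter_std l i : l2n (iter l (rmul_op R A) (std_vec R i)).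
Proof. by elim: l => [|l ih]; [exact: l2n_std|exact: l2n_rmul]. Qed.

Lemma sqnorm_iter_le l i :
  sqnorm (iter l (rmul_op R A) (std_vec R i)) <= (d ^+ 2) ^+ l.
Proof.
elim: l => [|l ih]; first by rewrite sqnorm_std.
rewrite iterS exprS (le_trans (op_norm_le A (l2n_iter_std l i))) //.
by rewrite ler_wpM2l // sqr_ge0.
Qed.

(** The traces of A grow no faster than its norm allows; those of the quotients
    may. *)
Lemma ring_trace_even_le l : (ring_trace A (l + l))%:~R <= n%:R * (d ^+ 2) ^+ l :> R.
Proof.
rewrite /ring_trace rmorph_sum mulr_natl.
have -> : (d ^+ 2) ^+ l *+ n = \sum_(i < n) (d ^+ 2) ^+ l by rewrite sumr_const card_ord.
by apply: ler_sum => i _; have := sqnorm_iter_le l i; rewrite (std_sqnorm_iter R Asa).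
Qed.

End Moments.

(** * Comparison of A with its quotients *)

Section Compare.
Variables (R : realType) (G : groupType) (n : nat) (A : 'M[groupRing G]_n).
Hypothesis Asa : selfadjoint A.
Variable N : nat -> normalSubgroup G.
Hypothesis AN : adapted A N.
Local Notation d := (op_norm (rmul_op R A)).
Local Notation D := (d ^+ 2).
Local Notation Ak k := (quotient_mx (N k) A).

Lemma quotient_spectrum j : exists (K : nat) (xs : seq R),
  [/\ (0 < K)%N, size xs = (n * K)%N, trace_sums A K xs (j ^ 2),
      1 <= \prod_(x <- xs | x != 0) `|x| &
      b2 R (Ak j) = K%:R^-1 * (nzeros xs)%:R].
Proof.
have [fin adp] := AN; have sa := selfadjoint_quotient (N j) Asa.
have [K [xs [K0 sxs trxs pxs]]] := finite_group_spectrum R (fin j) sa.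
exists K, xs; split => //; last by apply: b2_finite => // M l _; exact: trxs.
by move=> l lj; rewrite -trxs ring_trace_quotient // => i g; exact: adp.
Qed.

Let Abnd (x : 'I_n -> G -> R[i]) : l2n x -> sqnorm (rmul_op R A x) <= D * sqnorm x.
Proof. exact: op_norm_le. Qed.

Lemma normalized_count K (xs : seq R) (F : R) : (0 < K)%N -> size xs = (n * K)%N ->
  K%:R^-1 * (F * (size xs)%:R) = n%:R * F.
Proof. by move=> K0 ->; rewrite natrM; field; rewrite pnatr_eq0 -lt0n. Qed.

Lemma b2_le_quotient k (h : {poly R}) lam F : 0 < D -> 0 <= lam -> 0 <= F ->
  h.[0] = 1 -> (size (contr D * h ^+ 2)%R <= (k ^ 2).+1)%N ->
  (forall x, x != 0 -> (1 - x ^+ 2 / D) * h.[x] ^+ 2 + lam * ln (x ^+ 2) <= F) ->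
  b2 R A <= b2 R (Ak k) + n%:R * F.
Proof.
move=> D0 lam0 F0 h0 sp hF; have [K [xs [K0 sxs trxs pxs ->]]] := quotient_spectrum k.
have [_ _ /(_ h h0)/le_trans -> //] := b2_limit Asa D0 Abnd.
rewrite (poly_trace_sums trxs sp) -(normalized_count F K0 sxs) -mulrDr.
rewrite ler_wpM2l ?invr_ge0 //.
have f0 : (contr D * h ^+ 2).[0] = 1.
  by rewrite hornerM horner_contr horner_exp h0 expr0n mul0r subr0 expr1n mul1r.
have H := @sum_le_zeros R xs pxs (fun x => (contr D * h ^+ 2).[x]) (fun=> 0) lam F lam0 F0.
have {}H := H (fun=> lexx 0); rewrite f0 mul1r big1_eq !addr0 in H; apply: H => x x0.
by rewrite hornerM horner_contr horner_exp; exact: hF.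
Qed.

Lemma zeros_limit (c X : R) : 0 < c -> D <= c ->
  (exists2 C : R, 0 <= C & exists2 s : R, 0 <= s < 1 & exists l0, forall l, (l0 <= l)%N ->
     X <= poly_trace A (contr c ^+ l.*2) + C * s ^+ l) -> X <= b2 R A.
Proof.
move=> c0 Dc [C C0 [s /andP[s0 s1] [l0 h]]].
have cb (x : 'I_n -> G -> R[i]) : l2n x -> sqnorm (rmul_op R A x) <= c * sqnorm x.
  by move=> lx; rewrite (le_trans (Abnd lx)) // ler_wpM2r // sqnorm_ge0.
have [cv _ _] := b2_limit Asa c0 cb.
have cv1 : (fun l => poly_trace A (contr c ^+ l.*2)) @ \oo --> b2 R A.
  apply/cvgrPdist_le => e e0; have /cvgrPdist_le/(_ _ e0)[M _ hM] := cv.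
  exists M => // l Ml; apply: hM => /=; rewrite /= in Ml *.
  by rewrite (leq_trans Ml) // -addnn leq_addr.
have cv2 : (fun l => C * s ^+ l) @ \oo --> (0 : R).
  rewrite -(mulr0 C); apply: cvgM; first exact: cvg_cst.
  by apply: cvg_expr; rewrite ger0_norm.
have cv3 : (fun l => poly_trace A (contr c ^+ l.*2) + C * s ^+ l) @ \oo --> b2 R A.
  by rewrite -[b2 R A]addr0; apply: cvgD cv1 cv2.
rewrite -(cvg_lim _ cv3) //; apply: limr_ge; first by apply/cvg_ex; eexists; exact: cv3.
by exists l0 => // l /= /h.
Qed.

(** The kernel is taken for D' = D exp eta instead of D: then x^2/D' is smaller
    than 1 by a fixed factor on the spectrum of A, which makes the tail of the
    spectrum of A_j negligible as j grows. *)
Lemma quotient_le_b2 k r eta (m : R := (r.*2.+1)%:R) (rho := (m ^+ 2)^-1)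
    (lam := (1 - rho) / (2 * ln m)) : (0 < r)%N -> (4 * r <= k ^ 2)%N ->
  1 <= D -> 0 < eta ->
  b2 R (Ak k) <= b2 R A + n%:R * (rho + lam * (ln D + eta)).
Proof.
move=> r0 rk D1 eta0; have D0 : 0 < D := lt_le_trans ltr01 D1.
pose D' := D * expR eta; have D'0 : 0 < D' by rewrite mulr_gt0 ?expR_gt0.
have lnD' : ln D' = ln D + eta by rewrite lnM ?posrE ?expR_gt0 // expRK.
have m1 : 1 < m by rewrite /m ltr1n ltnS double_gt0.
have rho0 : 0 <= rho by rewrite invr_ge0 sqr_ge0.
have rho1 : rho <= 1 by rewrite /rho invf_cp1 ?exprn_gt0 ?exprn_ege1 ?ltW //; lra.
have lam0 : 0 <= lam by rewrite divr_ge0 ?subr_ge0 // mulr_ge0 // ltW // ln_gt0.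
have F0 : 0 <= rho + lam * (ln D + eta).
  by rewrite addr_ge0 // mulr_ge0 // addr_ge0 ?ln_ge0 // ltW.
pose C : R := 16 ^+ r + lam; have C0 : 0 <= C by rewrite addr_ge0 // exprn_ge0.
set F := rho + _ in F0 *; rewrite -lerBlDr; apply: (zeros_limit D0 (lexx _)).
exists (n%:R * C); first by rewrite mulr_ge0.
exists (expR (- eta)); first by rewrite expR_ge0 expR_lt1 oppr_lt0.
exists r.*2.+1 => l lr.
have [K [xs [K0 sxs trxs pxs ->]]] := quotient_spectrum k.
(* large enough for the traces of A up to degree 4l, and at least k *)
pose j := (k + 4 * l)%N.
have [K' [ys [K'0 sys trys pys _]]] := quotient_spectrum j.
have jk : (k ^ 2 <= j ^ 2)%N by rewrite leq_exp2r // leq_addr.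
have jl : (4 * l <= j ^ 2)%N.
  by rewrite (leq_trans (leq_addl k _)) // -/j; case: (j) => // ?; rewrite expnS leq_pmulr.
have szq := size_fejer_poly_sqr D' r.
have q1 : K%:R^-1 * (nzeros xs)%:R <= poly_trace A (fejer_poly D' r ^+ 2).
  rewrite (poly_trace_sums trxs); last by rewrite (leq_trans szq) // ltnS.
  rewrite ler_wpM2l ?invr_ge0 //.
  have := @zeros_le_sum R xs (fun x => (fejer_poly D' r ^+ 2).[x]).
  apply; first by rewrite horner_exp horner_fejer_poly0 expr1n.
  by move=> x; rewrite horner_exp sqr_ge0.
have q2 : poly_trace A (fejer_poly D' r ^+ 2) <= K'%:R^-1 * (nzeros ys)%:R + n%:R * F +
    C * (D' ^+ l)^-1 * (ring_trace A (l + l))%:~R.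
  rewrite (poly_trace_sums trys); last by rewrite (leq_trans szq) // ltnS (leq_trans rk).
  rewrite -(normalized_count F K'0 sys) (trys (l + l)%N); last first.
    by rewrite (leq_trans _ jl) // addnn -mul2n leq_mul2r orbT.
  rewrite (mulrCA (C * _)) -!mulrDr ler_wpM2l ?invr_ge0 //.
  have := @sum_le_zeros R ys pys (fun x => (fejer_poly D' r ^+ 2).[x])
    (fun x => C * (x ^+ 2 / D') ^+ l) lam F lam0 F0.
  rewrite horner_exp horner_fejer_poly0 expr1n mul1r.
  have -> : \sum_(x <- ys) C * (x ^+ 2 / D') ^+ l =
      C * (D' ^+ l)^-1 * \sum_(x <- ys) x ^+ (l + l).
    rewrite mulr_sumr; apply: eq_bigr => x _.
    by rewrite expr_div_n -exprM mul2n addnn -mulrA [_^-1 * _]mulrC.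
  apply=> x; first by rewrite mulr_ge0 // exprn_ge0 // divr_ge0 ?sqr_ge0 // ltW.
  move=> x0; have s0 : 0 < x ^+ 2 / D' by rewrite divr_gt0 // exprn_even_gt0.
  have := fejer_log_le r0 s0 lr; rewrite horner_fejer_poly_sqr -/m -/rho -/lam -/C.
  rewrite ln_div ?posrE ?exprn_even_gt0 // lnD' /F; lra.
have q3 := zeros_le_poly_trace_contr D trys jl.
have q4 : C * (D' ^+ l)^-1 * (ring_trace A (l + l))%:~R <= n%:R * C * expR (- eta) ^+ l.
  apply: le_trans (ler_wpM2l _ (ring_trace_even_le R Asa l)) _.
    by rewrite mulr_ge0 // invr_ge0 exprn_ge0 // ltW.
  rewrite /D' exprMn invfM expRN exprVn le_eqVlt; apply/orP; left; apply/eqP.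
  have a0 : D ^+ l != 0 by rewrite expf_neq0 // gt_eqF.
  have b0 : expR eta ^+ l != 0 by rewrite expf_neq0 // gt_eqF // expR_gt0.
  move: a0 b0; set a := _ ^+ l; set b := expR eta ^+ l => a0 b0.
  by field; rewrite a0 b0.
lra.
Qed.

End Compare.

(** * Operator norm below the square root of 2 *)

Section SmallNorm.
Variables (R : realType) (G : groupType) (n : nat) (A : 'M[groupRing G]_n).
Hypothesis Asa : selfadjoint A.
Local Notation d := (op_norm (rmul_op R A)).
Local Notation D := (d ^+ 2).
Local Notation coef l i := (((A ^+ l) i i)@_1%g).

Lemma coef_even_ge0 l i : 0 <= coef (l + l)%N i.
Proof.
by rewrite -(ler0z R) -(std_sqnorm_iter R Asa) sqnorm_ge0 //; exact: l2n_iter_std.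
Qed.

Lemma coef_step l i : (coef (l.+1 + l.+1) i)%:~R <= D * (coef (l + l) i)%:~R :> R.
Proof.
rewrite -!(std_sqnorm_iter R Asa) iterS; apply: op_norm_le; exact: l2n_iter_std.
Qed.

Lemma coef0 i : coef 0 i = 1.
Proof. by rewrite expr0 mxE eqxx -[true%:R]/(gr1 G) /gr1 mcoeffU eqxx. Qed.

Lemma int_lt2 (u : int) : (u%:~R : R) < 2 -> u <= 1.
Proof. by rewrite -[2]/(2%:~R) ltr_int; lia. Qed.

(** Both diagonal coefficients are nonnegative integers, u = |A e_i|^2 <= D < 2
    and v = |A^2 e_i|^2 <= D u, so u is 0 or 1 and v <= u. *)
Lemma ring_trace4_le_ring_trace2 : D < 2 -> ring_trace A 4 <= ring_trace A 2.
Proof.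
move=> D2; apply: ler_sum => i _.
have u0 := coef_even_ge0 1 i; have v0 := coef_even_ge0 2 i.
have := coef_step 0 i; rewrite coef0 mulr1 => uD.
have := coef_step 1 i => vD; rewrite !addn1 in u0 v0 uD vD.
have u1 := int_lt2 (le_lt_trans uD D2).
have [u_eq0|u_ne0] := eqVneq (coef 2 i) 0.
  by rewrite u_eq0 in vD *; rewrite mulr0 lerz0 in vD.
have u_eq1 : coef 2 i = 1 by lia.
by rewrite u_eq1 in vD *; rewrite mulr1 in vD; apply/int_lt2/(le_lt_trans vD).
Qed.

(** The entries of A are integers, so a row of norm below 1 vanishes. *)
Lemma op_norm_lt1 : d < 1 -> d = 0.
Proof.
move=> d1; have d0 := op_norm_ge0 R A.
have D1 : D < 1 by rewrite expr_lt1.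
have A0 i : iter 1 (rmul_op R A) (std_vec R i) = 0.
  apply: sqnorm_eq0; first exact: l2n_iter_std.
  rewrite (std_sqnorm_iter R Asa); have := coef_step 0 i; rewrite coef0 mulr1 => h.
  have := le_lt_trans h D1; rewrite -[1]/(1%:~R) ltr_int => h1.
  by have h2 := coef_even_ge0 1 i; have -> : coef (1 + 1) i = 0 by lia.
have Aij i j : A i j = 0.
  apply/malgP => g; rewrite mcoeff0; apply/eqP; rewrite -(intr_eq0 R[i]).
  have := congr1 (fun f => f j g) (A0 i); rewrite (iter_rmul_std R A 1 i) expr1.
  by move=> ->.
have T0 (x : 'I_n -> G -> R[i]) : rmul_op R A x = 0.
  apply/funext => j; apply/funext => g; rewrite /rmul_op big1 // => i _.
  by rewrite Aij msupp0 big_seq_fset0.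
have N0 : l2n_norm (0 : 'I_n -> G -> R[i]) = 0.
  by rewrite /l2n_norm l2n_dot0l ?sqrtr0 //; exact: l2n0.
apply/eqP; rewrite eq_le d0 andbT; apply: ge_sup.
  exists 0; exists 0; last by rewrite T0.
  by split; [exact: l2n0|rewrite N0].
by move=> _ [x _ <-]; rewrite T0 N0.
Qed.

End SmallNorm.

Section SmallCompare.
Variables (R : realType) (G : groupType) (n : nat) (A : 'M[groupRing G]_n).
Hypothesis Asa : selfadjoint A.
Variable N : nat -> normalSubgroup G.
Hypothesis AN : adapted A N.
Local Notation d := (op_norm (rmul_op R A)).
Local Notation D := (d ^+ 2).

(** The determinant bound with log y <= y - 1. *)
Lemma trace_le_zeros K (xs : seq R) M : (0 < K)%N -> size xs = (n * K)%N ->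
  trace_sums A K xs M -> 1 <= \prod_(x <- xs | x != 0) `|x| -> (2 <= M)%N ->
  n%:R - (ring_trace A 2)%:~R <= K%:R^-1 * (nzeros xs)%:R :> R.
Proof.
move=> K0 sxs trxs pxs M2.
have H := @sum_le_zeros R xs pxs (fun x => 1 - x ^+ 2) (fun=> 0) 1 0 ler01 (lexx _).
have {}H := H (fun=> lexx 0).
rewrite expr0n subr0 mul1r mul0r big1_eq !addr0 in H.
have K1 : 0 < K%:R^-1 :> R by rewrite invr_gt0 ltr0n.
have -> : n%:R - (ring_trace A 2)%:~R = K%:R^-1 * \sum_(x <- xs) (1 - x ^+ 2) :> R.
  rewrite big_split sumrN /= big_const_seq count_predT iter_addr_0 sxs trxs //.
  by rewrite mulrBr natrM; field; rewrite pnatr_eq0 -lt0n.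
rewrite ler_pM2l //; apply: H => x x0; rewrite mul1r.
have x20 : 0 < x ^+ 2 by rewrite exprn_even_gt0.
have : ln (1 + (x ^+ 2 - 1)) <= x ^+ 2 - 1 by apply: le_ln1Dx; lra.
by rewrite (addrC 1) subrK; lra.
Qed.

Lemma b2_eq_of_small k : (2 <= k)%N -> D < 2 -> b2 R A = b2 R (quotient_mx (N k) A).
Proof.
move=> k2 D2; have t42 := ring_trace4_le_ring_trace2 Asa D2.
have [K [xs [K0 sxs trxs pxs bk]]] := quotient_spectrum R Asa AN k.
have k4 : (4 <= k ^ 2)%N by rewrite -[4%N]/(2 ^ 2)%N leq_exp2r.
have cb (x : 'I_n -> G -> R[i]) : l2n x -> sqnorm (rmul_op R A x) <= 2 * sqnorm x.
  by move=> lx; rewrite (le_trans (op_norm_le A lx)) // ler_wpM2r ?sqnorm_ge0 // ltW.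
have tE : poly_trace A (contr 1 ^+ 2) <= n%:R - (ring_trace A 2)%:~R :> R.
  rewrite (poly_trace_sums trxs); last by rewrite (leq_trans (size_contrX _ _)).
  have -> : \sum_(x <- xs) (contr 1 ^+ 2).[x] =
     (n * K)%:R - 2 * (\sum_(x <- xs) x ^+ 2) + \sum_(x <- xs) x ^+ 4 :> R.
    rewrite -sxs.
    have -> : (size xs)%:R = \sum_(x <- xs) 1 :> R.
      by rewrite big_const_seq count_predT iter_addr_0.
    rewrite mulr_sumr -sumrN -!big_split; apply: eq_bigr => x _ /=.
    by rewrite horner_exp horner_contr; field.
  have -> : \sum_(x <- xs) x ^+ 2 = K%:R * (ring_trace A 2)%:~R :> R.
    by rewrite trxs ?(leq_trans _ k4) // mulVKf // pnatr_eq0 -lt0n.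
  have -> : \sum_(x <- xs) x ^+ 4 = K%:R * (ring_trace A 4)%:~R :> R.
    by rewrite trxs // mulVKf // pnatr_eq0 -lt0n.
  have -> : K%:R^-1 * ((n * K)%:R - 2 * (K%:R * (ring_trace A 2)%:~R) + K%:R * (ring_trace A 4)%:~R)
     = n%:R - 2 * (ring_trace A 2)%:~R + (ring_trace A 4)%:~R :> R.
    by rewrite natrM; field; rewrite pnatr_eq0 -lt0n.
  have : (ring_trace A 4)%:~R <= (ring_trace A 2)%:~R :> R by rewrite ler_int.
  lra.
have c10 : (contr (1 : R)).[0] = 1 by rewrite horner_contr expr0n mul0r subr0.
have bA_le : b2 R A <= n%:R - (ring_trace A 2)%:~R.
  have [_ /(_ _ c10) h _] := b2_limit Asa (ltr0n R 2) cb.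
  exact: le_trans tE.
have bk_le : b2 R (quotient_mx (N k) A) <= n%:R - (ring_trace A 2)%:~R.
  by rewrite bk; apply: le_trans tE; apply: (@zeros_le_poly_trace_contr _ _ _ _ _ _ _ _ 1 trxs).
have bk_ge : n%:R - (ring_trace A 2)%:~R <= b2 R (quotient_mx (N k) A).
  by rewrite bk; apply: (trace_le_zeros K0 sxs trxs pxs); rewrite (leq_trans _ k4).
have bA_ge : n%:R - (ring_trace A 2)%:~R <= b2 R A.
  apply: (@zeros_limit _ _ _ _ Asa 2) => //; first exact: ltW.
  exists 0 => //; exists 0; first by rewrite lexx ltr01.
  exists 1%N => l l0; rewrite mul0r addr0.
  pose j := (4 * l)%N.
  have [K' [ys [K'0 sys trys pys _]]] := quotient_spectrum R Asa AN j.
  have jl : (4 * l <= j ^ 2)%N by rewrite -/j expnS expn1 leq_pmull // /j; lia.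
  apply: le_trans (zeros_le_poly_trace_contr 2 trys jl).
  by apply: (trace_le_zeros K'0 sys trys pys); rewrite (leq_trans _ jl) //; lia.
lra.
Qed.

End SmallCompare.

(** * Choice of the degree *)

Lemma sqr_div4 k : (4 * (k ^ 2 %/ 4) <= k ^ 2 <= 4 * (k ^ 2 %/ 4) + 3)%N.
Proof. by have := divn_eq (k ^ 2) 4; have := ltn_pmod (k ^ 2) (isT : 0 < 4)%N; lia. Qed.

Lemma sqr_ge_mul a k : (a <= k)%N -> (a * k <= k ^ 2)%N.
Proof. by move=> ak; rewrite expnS expn1 leq_mul2r ak orbT. Qed.

Lemma upper_index k (r := (k ^ 2 %/ 4)%N) : (2 <= k)%N ->
  [/\ (0 < r)%N, (k <= r.*2.+1)%N &
      (4 <= k)%N -> (2 * k <= r.*2.+1)%N /\ (9 <= r.*2.+1)%N].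
Proof.
move=> k2; have /andP[q1 q2] := sqr_div4 k; have kk := sqr_ge_mul k2.
have [|k5] := leqP k 4; first by case: k @r {q1 q2 kk} k2 => [|[|[|[|[|]]]]].
have kk5 := sqr_ge_mul k5.
by rewrite /r; move: (k ^ 2)%N q1 q2 kk kk5 => ? *; split; last split; lia.
Qed.

Lemma lower_index k (r := (k ^ 2 %/ 4 - 1)%N) : (4 <= k)%N ->
  [/\ (0 < r)%N, (4 * r + 2 <= k ^ 2)%N & (3 * k <= 2 * r.*2.+1)%N].
Proof.
move=> k4; have /andP[q1 q2] := sqr_div4 k; have kk := sqr_ge_mul k4.
by rewrite /r; move: (k ^ 2)%N q1 q2 kk => ? *; split; lia.
Qed.

Section Numerics.
Variable R : realType.
Implicit Types (x m rho L : R) (k : nat).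

Lemma ln_ge_1BV x : 0 < x -> 1 - x^-1 <= ln x.
Proof.
move=> x0; have h : ln (1 + (x^-1 - 1)) <= x^-1 - 1.
  by apply: le_ln1Dx; rewrite ltrBrDl subrr invr_gt0.
rewrite (addrC 1) subrK lnV ?posrE // in h; lra.
Qed.

Lemma ln_le_B1 x : 0 < x -> ln x <= x - 1.
Proof. by move=> x0; have := @le_ln1Dx R (x - 1); rewrite (addrC 1) subrK; apply; lra. Qed.

Lemma ln2_ge : 1 / 2 <= ln 2 :> R.
Proof. by have := @ln_ge_1BV 2 ltac:(lra); lra. Qed.

Lemma ln2_le : ln 2 <= 1 :> R.
Proof. by have := @ln_le_B1 2 ltac:(lra); lra. Qed.

Lemma ln4 : ln 4 = 2 * ln 2 :> R.
Proof. by rewrite (_ : 4 = 2 ^+ 2); [rewrite lnXn // [RHS]mulr_natl|ring]. Qed.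

(** M stands for log m, kap for log k and L for log d: an error rho is paid for by
    the gain L/kap - L/M. *)
Lemma main_term_le (M kap rho L : R) : 0 < kap -> kap < M -> 0 <= L ->
  0 <= rho -> rho * kap * M <= L * (M - kap) ->
  rho + (1 - rho) / (2 * M) * (2 * L) <= L / kap.
Proof.
move=> k0 kM L0 r0 h; have M0 : 0 < M by lra.
have -> : (1 - rho) / (2 * M) * (2 * L) = (1 - rho) * (L / M).
  by field; rewrite gt_eqF.
have h1 : rho <= L / kap - L / M.
  have -> : L / kap - L / M = L * (M - kap) / (kap * M) by field; rewrite !gt_eqF.
  by rewrite ler_pdivlMr ?mulr_gt0 // mulrA.
have : 0 <= rho * (L / M) by rewrite mulr_ge0 // divr_ge0 // ltW.
lra.
Qed.

Section LargeNorm.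
Variables (d : R) (k : nat).
Hypotheses (d0 : 0 <= d) (d2 : 2 <= d ^+ 2) (k2 : (2 <= k)%N).
Local Notation L := (ln d).
Local Notation E := ((1 - 1 / (k%:R * d)) ^+ (k ^ 2)).

Lemma d_ge75 : 7 / 5 <= d.
Proof.
rewrite -(@ler_pXn2r _ 2) ?nnegrE //.
by apply: le_trans d2; lra.
Qed.

Lemma d_gt0 : 0 < d. Proof. by have := d_ge75; lra. Qed.

Lemma lnD_eq : ln (d ^+ 2) = 2 * L.
Proof. by rewrite lnXn ?d_gt0 // mulr_natl. Qed.

Lemma L_ge : 1 / 4 <= L.
Proof.
have : ln 2 <= ln (d ^+ 2) by rewrite ler_ln ?posrE ?exprn_gt0 ?d_gt0.
have := ln2_ge; rewrite lnD_eq; lra.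
Qed.

Lemma base_ge (c : R) : 0 <= c -> 1 <= (1 - c) * (k%:R * d) -> c <= 1 - 1 / (k%:R * d).
Proof.
move=> c0 h; have kd : 0 < k%:R * d by rewrite mulr_gt0 ?d_gt0 // ltr0n (leq_trans _ k2).
by rewrite lerBrDl -lerBrDr ler_pdivrMr.
Qed.

Lemma kd_ge1 : 0 <= 1 - 1 / (k%:R * d).
Proof.
apply: base_ge => //; rewrite subr0 mul1r.
have k1 : 2 <= k%:R :> R by rewrite (ler_nat _ 2).
have d75 := d_ge75.
have h : 2 * (7 / 5) <= k%:R * d by apply: ler_pM => //; lra.
lra.
Qed.

Lemma E_ge0 : 0 <= E. Proof. by rewrite exprn_ge0 // kd_ge1. Qed.

Lemma E_ge (c : R) : 0 <= c -> 1 <= (1 - c) * (k%:R * d) -> c ^+ (k ^ 2) <= E.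
Proof.
move=> c0 h; have ch := base_ge c0 h; rewrite ler_pXn2r ?expn_gt0 ?(leq_trans _ k2) //.
by rewrite nnegrE kd_ge1.
Qed.

Lemma lnk_gt0 : 0 < ln k%:R :> R.
Proof. by rewrite ln_gt0 // ltr1n. Qed.

(** For k = 2 the polynomial 1 - X^2/D with weight 1/D gives the left-hand side;
    with D = 2u the inequality reads log 2 (1 - 1/u) <= log u. *)
Lemma lower_k2 : k = 2 -> 1 - (d ^+ 2)^-1 <= L / ln k%:R.
Proof.
move=> ->; have l2 : 0 < ln 2 :> R by have := ln2_ge; lra.
rewrite ler_pdivlMr //.
have D2 := d2; set D := d ^+ 2 in D2 *.
have D0 : 0 < D by rewrite exprn_gt0 // d_gt0.
have h1 : ln D = ln 2 + ln (D / 2).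
  by rewrite -lnM ?posrE ?divr_gt0 //; congr ln; field.
have h2 := @ln_ge_1BV (D / 2) (divr_gt0 D0 (ltr0n R 2)).
have h3 : L = ln D / 2 by rewrite lnD_eq; field.
have DV : 0 < D^-1 by rewrite invr_gt0.
have DV2 : D^-1 <= 1 / 2 by rewrite -[X in X <= _]mul1r ler_pdivrMr //; lra.
have l2le := ln2_le.
have : 0 <= (1 - ln 2) * (1 - 2 * D^-1) by rewrite mulr_ge0 ?subr_ge0 //; lra.
rewrite h3 h1; rewrite invf_div in h2.
lra.
Qed.

(** For k >= 4 one has m >= 3k/2 and the gain log m - log k >= 1/3 is enough.
    For k = 3 there is no gain, as m = 3, and the exponential term of the estimate
    covers rho. *)
Lemma lower_degree : (3 <= k)%N -> exists r rho,
  let m : R := (r.*2.+1)%:R in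
  [/\ (0 < r)%N, (4 * r + 2 <= k ^ 2)%N, 9 / 256 / ln m ^+ 2 <= rho <= 1 &
      rho + (1 - rho) / (2 * ln m) * (2 * L) <= E + L / ln k%:R].
Proof.
move=> k3; have Lg := L_ge; have E0 := E_ge0; have d75 := d_ge75.
have l32 : 1 / 3 <= ln (3 / 2) :> R.
  by have := @ln_ge_1BV (3 / 2) ltac:(lra); lra.
have l3 : 5 / 6 <= ln 3 :> R.
  have -> : (3 : R) = 2 * (3 / 2) by field.
  by rewrite lnM ?posrE; have := ln2_ge; lra.
have [k_eq3|k_ne3] := eqVneq k 3%N.
  exists 1%N, (9 / 256 / ln 3 ^+ 2) => m.
  have -> : m = 3 by [].
  rewrite k_eq3.
  have s3 : 25 / 36 <= ln 3 ^+ 2 :> R.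
    have -> : 25 / 36 = (5 / 6) ^+ 2 :> R by field.
    by rewrite ler_pXn2r ?nnegrE //; lra.
  have r34 : 9 / 256 / ln 3 ^+ 2 <= (3 / 4) ^+ 9 :> R.
    rewrite ler_pdivrMr; last by lra.
    have : (3 / 4) ^+ 9 * (25 / 36) <= (3 / 4) ^+ 9 * ln 3 ^+ 2 :> R.
      by rewrite ler_pM2l // exprn_gt0 //; lra.
    by apply: le_trans; lra.
  have r0 : 0 <= 9 / 256 / ln 3 ^+ 2 :> R by rewrite divr_ge0 ?sqr_ge0.
  split => //; first by rewrite lexx (le_trans r34) // exprn_ile1 //; lra.
  have EE : (3 / 4) ^+ 9 <= E.
    have := @E_ge (3 / 4) ltac:(lra); rewrite k_eq3; apply; lra.
  rewrite k_eq3 in EE.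
  have -> : (1 - 9 / 256 / ln 3 ^+ 2) / (2 * ln 3) * (2 * L) =
      (1 - 9 / 256 / ln 3 ^+ 2) * (L / ln 3).
    by field; rewrite gt_eqF //; lra.
  have : 0 <= (9 / 256 / ln 3 ^+ 2) * (L / ln 3).
    by rewrite mulr_ge0 // divr_ge0 //; lra.
  lra.
have k4 : (4 <= k)%N by lia.
pose r := ((k ^ 2) %/ 4 - 1)%N.
have [r0 rk mk] := lower_index k4; rewrite -/r in r0 rk mk.
exists r, (9 / 256 / ln (r.*2.+1)%:R ^+ 2) => m.
rewrite -/m; have mkR : 3 / 2 * k%:R <= m.
  have : (3 * k)%:R <= (2 * r.*2.+1)%:R :> R by rewrite ler_nat.
  by rewrite !natrM -/m; lra.
have kR : 4 <= k%:R :> R by rewrite (ler_nat _ 4).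
have lk1 : 1 <= ln k%:R :> R.
  apply: (@le_trans _ _ (ln 4)); last by rewrite ler_ln ?posrE //; lra.
  by rewrite ln4; have := ln2_ge; lra.
have lmk : ln k%:R + 1 / 3 <= ln m :> R.
  apply: (@le_trans _ _ (ln (3 / 2 * k%:R))); last by rewrite ler_ln ?posrE //; lra.
  by rewrite lnM ?posrE; lra.
set M := ln m in lmk *; set kap := ln _ in lk1 lmk *.
have M0 : 0 < M by lra.
have M2 : 1 <= M ^+ 2 by rewrite exprn_ege1 //; lra.
have rho0 : 0 <= 9 / 256 / M ^+ 2 by rewrite divr_ge0 ?sqr_ge0.
split => //.
  by rewrite lexx ler_pdivrMr ?mul1r; lra.
rewrite -[leLHS]add0r lerD //; apply: main_term_le => //; try lra.
have -> : 9 / 256 / M ^+ 2 * kap * M = 9 / 256 * (kap / M) by field; rewrite gt_eqF.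
have h1 : kap / M <= 1 by rewrite ler_pdivrMr ?mul1r //; lra.
have : 1 / 4 * (1 / 3) <= L * (M - kap) by apply: ler_pM => //; lra.
lra.
Qed.

(** For k >= 4 one has m >= 2k, and the gain log m - log k >= 1/2 is enough; for
    k = 2 and k = 3 the exponential term covers rho. *)
Lemma upper_degree : exists r,
  let m : R := (r.*2.+1)%:R in let rho := (m ^+ 2)^-1 in
  [/\ (0 < r)%N, (4 * r <= k ^ 2)%N &
      rho + (1 - rho) / (2 * ln m) * (2 * L) <= E + L / ln k%:R].
Proof.
have Lg := L_ge; have E0 := E_ge0; have d75 := d_ge75; have lk0 := lnk_gt0.
pose r := ((k ^ 2) %/ 4)%N; exists r => m rho.
have /andP[rk _] := sqr_div4 k; have [r0 km k4_bnd] := upper_index k2.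
rewrite -/r in rk r0 km k4_bnd.
have kmR : k%:R <= m :> R by rewrite ler_nat.
have kR : 2 <= k%:R :> R by rewrite (ler_nat _ 2).
have m1 : 1 < m by lra.
have rho0 : 0 <= rho by rewrite invr_ge0 sqr_ge0.
split => //.
have lkm : ln k%:R <= ln m :> R by rewrite ler_ln ?posrE //; lra.
have M0 : 0 < ln m by lra.
have small : rho <= E -> rho + (1 - rho) / (2 * ln m) * (2 * L) <= E + L / ln k%:R.
  move=> rE; have -> : (1 - rho) / (2 * ln m) * (2 * L) = (1 - rho) * (L / ln m).
    by field; rewrite gt_eqF.
  have h1 : L / ln m <= L / ln k%:R by rewrite ler_wpM2l ?lef_pV2 ?posrE //; lra.
  have h2 : 0 <= rho * (L / ln m) by rewrite mulr_ge0 // divr_ge0 //; lra.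
  lra.
have [k_eq2|k_ne2] := eqVneq k 2%N.
  apply: small; have := @E_ge (9 / 14) ltac:(lra).
  rewrite /rho /m /r k_eq2 => h; apply: le_trans (h _); last by lra.
  have -> : ((2 ^ 2 %/ 4).*2.+1)%:R = 3 :> R by [].
  by rewrite -[(2 ^ 2)%N]/4%N; lra.
have [k_eq3|k_ne3] := eqVneq k 3%N.
  apply: small; have := @E_ge (3 / 4) ltac:(lra).
  rewrite /rho /m /r k_eq3 => h; apply: le_trans (h _); last by lra.
  have -> : ((3 ^ 2 %/ 4).*2.+1)%:R = 5 :> R by [].
  by rewrite -[(3 ^ 2)%N]/9%N; lra.
have k4 : (4 <= k)%N by case: (k) k2 k_ne2 k_ne3 => [|[|[|[|]]]].
have [m2k m9'] := k4_bnd k4.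
have m9 : 9 <= m by rewrite /m (ler_nat _ 9).
have mkR : 2 * k%:R <= m by rewrite -natrM ler_nat.
have lmk : ln k%:R + 1 / 2 <= ln m :> R.
  apply: (@le_trans _ _ (ln (2 * k%:R))); last by rewrite ler_ln ?posrE //; lra.
  by rewrite lnM ?posrE; have := ln2_ge; lra.
have lm4 : ln m <= 1 + m / 4.
  have -> : ln m = 2 * ln 2 + ln (m / 4).
    by rewrite -ln4 -lnM ?posrE; [congr ln; field|lra|lra].
  have := @ln_le_B1 (m / 4) ltac:(lra); have := ln2_le; lra.
rewrite -[leLHS]add0r lerD //; apply: main_term_le => //; try lra.
have h1 : 1 / 4 * (1 / 2) <= L * (ln m - ln k%:R) by apply: ler_pM => //; lra.
have m20 : 0 < m ^+ 2 by apply: exprn_gt0; lra.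
apply: le_trans h1; rewrite /rho -mulrA mulrC ler_pdivrMr //.
have h2 : ln k%:R * ln m <= (ln m - 1 / 2) * ln m by rewrite ler_wpM2r //; lra.
apply: (le_trans h2).
have h3 : (ln m - 1 / 2) * ln m <= (1 / 2 + m / 4) * (1 + m / 4) by apply: ler_pM; lra.
apply: (le_trans h3).
have : 0 <= (m - 9) * m by rewrite mulr_ge0 //; lra.
rewrite expr2; lra.
Qed.

End LargeNorm.
End Numerics.

(** * The estimate *)

Section Bounds.
Variables (R : realType) (G : groupType) (n : nat) (A : 'M[groupRing G]_n).
Hypothesis Asa : selfadjoint A.
Variable N : nat -> normalSubgroup G.
Hypothesis AN : adapted A N.
Variable k : nat.
Hypothesis k_ge2 : (2 <= k)%N.
Variable d : R.
Hypothesis dE : op_norm (rmul_op R A) = d.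
Local Notation Ak := (quotient_mx (N k) A).
Local Notation E := ((1 - 1 / (k%:R * d)) ^+ (k ^ 2)).
Hypothesis d2 : 2 <= d ^+ 2.

Lemma b2_lower_bound : b2 R A <= b2 R Ak + n%:R * (E + ln d / ln k%:R).
Proof.
have D2 := d2; have d0 := op_norm_ge0 R A; rewrite dE in d0; have D0 : 0 < d ^+ 2 by lra.
have cert := @b2_le_quotient R _ _ _ Asa _ AN; rewrite dE in cert.
have E0 := E_ge0 d0 d2 k_ge2; have Lg := L_ge d0 d2.
have [k_eq2|k_ne2] := eqVneq k 2%N.
  have h := lower_k2 d0 d2 k_eq2.
  have DV : 0 < (d ^+ 2)^-1 by rewrite invr_gt0.
  have DV1 : (d ^+ 2)^-1 <= 1 by rewrite invf_cp1 //; lra.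
  apply: (@le_trans _ _ (b2 R Ak + n%:R * (1 - (d ^+ 2)^-1))).
    apply: (cert k 1 (d ^+ 2)^-1) => //.
    - exact: ltW.
    - by rewrite subr_ge0.
    - by rewrite hornerC.
    - by rewrite expr1n mulr1 k_eq2 (leq_trans (size_contrX _ 1)).
    move=> x x0; rewrite hornerC expr1n mulr1.
    have x20 : 0 < x ^+ 2 by rewrite exprn_even_gt0.
    have := ler_wpM2l (ltW DV) (ln_le_B1 x20).
    have -> : x ^+ 2 / d ^+ 2 = (d ^+ 2)^-1 * x ^+ 2 by rewrite mulrC.
    lra.
  by rewrite lerD2l ler_wpM2l //; lra.
have k3 : (3 <= k)%N by lia.
have [r [rho [r0 rk rho01 bnd]]] := lower_degree d0 d2 k_ge2 k3.
apply: (@le_trans _ _ (b2 R Ak + n%:R * (rho +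
    (1 - rho) / (2 * ln (r.*2.+1)%:R) * (2 * ln d)))); last first.
  by rewrite lerD2l ler_wpM2l.
have m1 : 1 < (r.*2.+1)%:R :> R by rewrite ltr1n ltnS double_gt0.
have lam0 : 0 <= (1 - rho) / (2 * ln (r.*2.+1)%:R).
  rewrite divr_ge0 ?subr_ge0 ?(andP rho01).2 // mulr_ge0 // ltW // ln_gt0 //.
have rho0 : 0 <= rho.
  by apply: le_trans (andP rho01).1; rewrite divr_ge0 ?sqr_ge0.
apply: (cert _ (fejer_poly (d ^+ 2) r) _ _ D0 lam0).
- by rewrite addr_ge0 // mulr_ge0 // mulr_ge0 //; lra.
- exact: horner_fejer_poly0.
- rewrite (leq_trans (size_polyMleq _ _)) //.
  have := size_contrX (d ^+ 2) 1; rewrite expr1.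
  have := size_fejer_poly_sqr (d ^+ 2) r.
  move: (size (fejer_poly _ _ ^+ 2)%R) (size (contr _)) => a b; lia.
move=> x x0; have s0 : 0 < x ^+ 2 / d ^+ 2 by rewrite divr_gt0 // exprn_even_gt0.
have := fejer_contr_log_le r0 s0 rho01.
rewrite -horner_fejer_poly_sqr horner_exp ln_div ?posrE ?D0 ?exprn_even_gt0 //.
rewrite (lnD_eq d0 d2); lra.
Qed.

Lemma b2_upper_bound : b2 R Ak <= b2 R A + n%:R * (E + ln d / ln k%:R).
Proof.
have D2 := d2; have d0 := op_norm_ge0 R A; rewrite dE in d0; have [r [r0 rk bnd]] := upper_degree d0 d2 k_ge2.
set m : R := (r.*2.+1)%:R in bnd; set lam := (1 - m ^- 2) / (2 * ln m) in bnd.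
have m1 : 1 < m by rewrite ltr1n ltnS double_gt0.
have lam0 : 0 <= lam.
  rewrite divr_ge0 ?subr_ge0 //; last by rewrite mulr_ge0 // ltW // ln_gt0.
  by rewrite invf_cp1 ?exprn_gt0 ?exprn_ege1 ?ltW //; lra.
apply/ler_addgt0Pl => eps e0.
have c0 : 0 < n%:R * lam + 1 by rewrite ltr_wpDl // mulr_ge0.
pose eta := eps / (n%:R * lam + 1).
have D1 : 1 <= d ^+ 2 by lra.
have eta0 : 0 < eta by rewrite divr_gt0.
have cert := @quotient_le_b2 R _ _ _ Asa _ AN k r eta r0 rk; rewrite dE in cert.
have {}cert : b2 R Ak <= b2 R A + n%:R * (m ^- 2 + lam * (2 * ln d + eta)).
  by rewrite -(lnD_eq d0 d2); exact: cert.
have h1 : n%:R * lam * eta <= eps.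
  have -> : eps = (n%:R * lam + 1) * eta.
    by rewrite /eta mulrCA divff ?mulr1 // gt_eqF.
  by rewrite ler_pM2r // lerDl.
have h2 := ler_wpM2l (ler0n R n) bnd.
move: cert h2; set u := n%:R * (E + _).
have -> : n%:R * (m ^- 2 + lam * (2 * ln d + eta)) =
  n%:R * (m ^- 2 + lam * (2 * ln d)) + n%:R * lam * eta by ring.
move=> cert h2; apply: (le_trans cert).
by rewrite [leRHS]addrC -addrA lerD2l lerD.
Qed.

End Bounds.

Theorem proposition6p6 (R : realType) (G : groupType)
    (Gcountable : countable [set: G]) (Gresfin : residually_finite G)
    (n : nat) (A : 'M[groupRing G]_n) (Asa : selfadjoint A)
    (N : nat -> normalSubgroup G) (AN : adapted A N)
    (k : nat) (k_ge2 : (2 <= k)%N) :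
  let d := op_norm (rmul_op R A) in
  `|b2 R A - b2 R (quotient_mx (N k) A)| <=
    n%:R * (1 - 1 / (k%:R * d)) ^+ (k ^ 2) + n%:R * ln d / ln k%:R.
Proof.
cbv zeta; set d := op_norm _; have d0 : 0 <= d := op_norm_ge0 R A.
rewrite -[_ * _ / _]mulrA -mulrDr.
have [d2|d2] := leP 2 (d ^+ 2).
  have := b2_lower_bound Asa AN k_ge2 erefl d2.
  have := b2_upper_bound Asa AN k_ge2 erefl d2.
  rewrite -/d; set e := n%:R * _ => h1 h2.
  by rewrite ler_norml lerBlDl h2 andbT lerNl opprB lerBlDl.
rewrite (b2_eq_of_small Asa AN k_ge2 d2) subrr normr0 mulr_ge0 //.
have lk : 0 < ln k%:R :> R by rewrite ln_gt0 // ltr1n.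
have [d1|d1] := leP 1 d.
  rewrite addr_ge0 ?divr_ge0 ?(ltW lk) ?ln_ge0 // exprn_ge0 // subr_ge0.
  have k1 : 1 <= k%:R :> R by rewrite ler1n ltnW.
  have kd : 1 <= k%:R * d by rewrite mulr_ege1.
  by rewrite ler_pdivrMr ?mul1r // (lt_le_trans ltr01 kd).
rewrite /d (op_norm_lt1 Asa d1) mulr0 invr0 mulr0 subr0 expr1n.
by rewrite ln0 // mul0r addr0.
Qed.
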